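(* Let $\bar{D}$ be any knot projection with $n$ crossings, and let $A_2 = A_2(\bar{D}) \in M_{n,n+2}(\mathbb{Z})$ be its region choice matrix of the double counting rule. For every integral vector $\boldsymbol{b} \in \mathbb{Z}^n$ there exists $\boldsymbol{u} \in \mathbb{Z}^{n+2}$ such that $$A_2 \boldsymbol{u} + \boldsymbol{b} = \boldsymbol{o}.$$
   Context: A knot projection $\bar{D}$ is the image of a generic immersion of a circle in the sphere $S^2$ (or in the plane, in which case the unbounded region is counted as a region); its only singularities are finitely many transverse double points, called crossings. The connected components of the complement are called regions. If there are $n$ crossings $v_1,\dots,v_n$, then there are $n+2$ regions $r_1,\dots,r_{n+2}$. Around each crossing there are four corners, each lying in a region. A region touches a crossing once (respectively twice) if exactly one (respectively exactly two) of the four corners at that crossing lie in the region. The region choice matrix of the double counting rule is $A_2(\bar{D}) = (a^{(2)}_{ij}) \in M_{n,n+2}(\mathbb{Z})$, where $a^{(2)}_{ij} = 2$ if the region $r_j$ touches the crossing $v_i$ twice, $a^{(2)}_{ij}=1$ if $r_j$ touches $v_i$ once, and $a^{(2)}_{ij}=0$ otherwise. The symbol $\boldsymbol{o}$ denotes the zero vector. *)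

(* Defs.v *)
From HB Require Import structures.
From mathcomp Require Import all_boot all_order all_algebra.
From mathcomp Require Import all_classical all_reals all_analysis.

Set Implicit Arguments.
Unset Strict Implicit.
Unset Printing Implicit Defensive.

Import Order.TTheory GRing.Theory Num.Theory.
Import numFieldNormedType.Exports.

Local Open Scope classical_set_scope.
Local Open Scope card_scope.
Local Open Scope ring_scope.

Variant surface := Sphere | Plane.

(* The sphere is the unit sphere of R^3, the plane is R^2. *)
Definition ambient_dim (M : surface) : nat :=
  match M with Sphere => 3 | Plane => 2 end.

(* The library norm `|x| of a row vector is the sup norm. *)
Definition euclidean_norm (R : realType) (d : nat) (x : 'rV[R]_d) : R :=
  Num.sqrt (\sum_i x 0 i ^+ 2).

Definition points (R : realType) (M : surface) : set 'rV[R]_(ambient_dim M) :=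
  match M with
  | Sphere => [set x | euclidean_norm x = 1]
  | Plane => [set: 'rV[R]_2]
  end.
Arguments points : clear implicits.

(* Brings back to the surface the points of its tangent planes: radial
   projection for the sphere, nothing to do for the plane. *)
Definition to_surface (R : realType) (M : surface) :
    'rV[R]_(ambient_dim M) -> 'rV[R]_(ambient_dim M) :=
  match M with
  | Sphere => fun x => (euclidean_norm x)^-1 *: x
  | Plane => id
  end.
Arguments to_surface : clear implicits.

Section KnotProjection.
Variables (R : realType) (M : surface).
Local Notation V := 'rV[R]_(ambient_dim M).

(* The circle is R / Z: a closed curve is a 1-periodic function on R, and each
   point of the circle has exactly one representative t with 0 <= t < 1. *)
Definition double_at (g : R -> V) (s t : R) (v : V) : Prop :=
  [/\ 0 <= s < 1, 0 <= t < 1, s < t, g s = v & g t = v].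

Definition crossings (g : R -> V) : set V :=
  [set v | exists s t, double_at g s t v].

(* C^1 immersions of the circle in the surface whose only singularities are
   finitely many transverse double points. *)
Record generic_immersion (g : R -> V) : Prop := GenericImmersion {
  gi_surface : forall t, points R M (g t);
  gi_periodic : forall t, g (t + 1) = g t;
  gi_derivable : forall t, derivable g t 1;
  gi_C1 : continuous (derive1 g);
  gi_immersion : forall t, derive1 g t != 0;
  gi_finite : finite_set (crossings g);
  gi_double : forall s t u : R, 0 <= s < 1 -> 0 <= t < 1 -> 0 <= u < 1 ->
    g s = g t -> g t = g u -> [\/ s = t, t = u | s = u];
  gi_transverse : forall s t v, double_at g s t v ->
    row_free (col_mx (derive1 g s) (derive1 g t))
}.

Definition regions (g : R -> V) : set (set V) :=
  [set connected_component (points R M `\` range g) x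
     | x in points R M `\` range g].

(* If a and b are the velocities of the two branches through the crossing v,
   the four corners at v are the open sectors of the tangent plane cut out by
   the lines R a and R b; each sector is represented by the direction
   +-a +-b, which lies in its interior. *)
Definition corners (g : R -> V) (v : V) : set V :=
  [set w | exists s t (e f : bool),
     double_at g s t v /\
     w = (-1) ^+ e *: derive1 g s + (-1) ^+ f *: derive1 g t].

(* The corner w at v lies in U: when leaving v in the direction w, one is
   in U at all sufficiently small positive distances. *)
Definition corner_in (v w : V) (U : set V) : Prop :=
  \forall h \near 0^'+, U (to_surface R M (v + h *: w)).

Definition touches (g : R -> V) (k : nat) (U : set V) (v : V) : Prop :=
  [set w | corners g v w /\ corner_in v w U] #= `I_k.

Definition region_choice_matrix (g : R -> V) (n : nat)
    (v : 'I_n -> V) (r : 'I_(n + 2) -> set V) : 'M[int]_(n, n + 2) :=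
  \matrix_(i, j)
    (if `[< touches g 2%N (r j) (v i) >] then 2
     else if `[< touches g 1%N (r j) (v i) >] then 1
     else 0).

End KnotProjection.

(* Main.v *)
Require Import Defs.
From mathcomp Require Import all_boot all_order all_algebra.
From mathcomp Require Import all_classical all_reals all_analysis.
From mathcomp Require Import ring lra zify.

Set Implicit Arguments.
Unset Strict Implicit.
Unset Printing Implicit Defensive.

Import Order.TTheory GRing.Theory Num.Theory.
Import numFieldNormedType.Exports.

Local Open Scope classical_set_scope.
Local Open Scope card_scope.
Local Open Scope ring_scope.

(** The value of [A_2 u] at a crossing is the sum of the weights of its four
    corners, so it suffices to find, for every crossing [c], integral weights
    whose corner sums vanish at every other crossing and are a unit at [c].
    Smoothing the projection at [c] leaves the closed subarc [alpha] that
    runs along the curve between the two passages through [c].  The weight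
    of a region is [eps * W], where [W] is the winding number of [alpha]
    around the region and [eps] is the checkerboard sign, i.e. the parity of
    the winding number of the whole curve.

    Crossing one strand of a curve changes the winding number by one, with a
    sign given by the direction of the strand.  Hence [eps] changes sign
    between adjacent corners ([checkerboard]), which also shows that at most
    two corners at a crossing lie in the same region, so that an entry of
    [A_2] is exactly the number of corners of that crossing in that region.
    The corner sum of [eps * W] is therefore, up to sign, the alternating sum
    of [W] over the corners, i.e. the difference of two jumps of [W]: across
    the outgoing half of a strand and across its incoming half.  At another
    crossing [alpha] contains both halves or neither, and the jumps cancel
    ([alternating_other]); at [c] the arc [alpha] leaves along one half and
    does not contain the other, so that the sum is a unit
    ([alternating_self]).

    All of this takes place in a planar chart.  The plane is its own chart; a
    sphere is projected stereographically from a point [q] of a region, and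
    the winding number is extended by zero at [q], as it vanishes around
    points whose images are far away ([index_function], [sphere_chart]).

    Winding numbers are increments of continuous angle functions.  For two
    points [p] and [p'] the difference of the angles of [g - p] and [g - p']
    is an angle of the complex number [(g - p) * conj (g - p')], whose real
    and imaginary parts are a dot and a cross product.  This number is real
    and nonpositive exactly when [g] is on the segment [p p'].  Therefore two
    winding numbers agree when the curve does not meet the segment
    ([winds_eq]), and differ by one when it meets it along one transverse
    strand ([winds_cross]).  The second case is only needed for two points in
    adjacent corners, very close to the crossing; there, linear functionals
    on the tangent plane together with the compactness of the time interval
    control where the curve can meet the segment ([jump_forward],
    [jump_backward]). *)

(** * Locally constant functions on connected sets *)
Section LocallyConstant.

(** The points satisfying [P] form a subset of [A] that is both relatively open
    and relatively closed. *)
Lemma connected_locally_iff (T : topologicalType) (A : set T) (P : T -> Prop) :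
  connected A ->
  (forall x, A x -> \forall y \near x, A y -> (P x <-> P y)) ->
  forall x y, A x -> A y -> P x -> P y.
Proof.
move=> cA loc x y Ax Ay Px.
have interiorE (Q : T -> Prop) :
    (forall x, A x -> \forall y \near x, A y -> (Q x <-> Q y)) ->
    A `&` [set z | Q z] = A `&` interior [set z | A z -> Q z].
  move=> locQ; apply/seteqP; split=> z [Az Qz]; split => //.
    by rewrite /interior /=; apply: filterS (locQ z Az) => w h Aw; apply/(h Aw).
  exact: (nbhs_singleton Qz).
have locN z : A z -> \forall w \near z, A w -> (~ P z <-> ~ P w).
  by move=> Az; apply: filterS (loc z Az) => w h Aw; rewrite (propext (h Aw)).
have : A `&` [set z | P z] = A.
  apply: cA.
  - by exists x.
  - by exists (interior [set z | A z -> P z]);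
      [exact: open_interior | exact: interiorE].
  - exists (~` interior [set z | A z -> ~ P z]).
      by apply: open_closedC; exact: open_interior.
    have /seteqP[s1 s2] := interiorE _ locN.
    apply/seteqP; split=> z [Az /= Pz]; split => //.
      by move=> h; have [] := s2 z (conj Az h).
    by apply: contrapT => nP; apply: Pz; have [] := s1 z (conj Az nP).
by move=> /seteqP[_ /(_ y Ay)] [].
Qed.

Lemma connected_locally_constant (T : topologicalType) (I : Type) (A : set T)
    (f : T -> I) : connected A ->
  (forall x, A x -> \forall y \near x, A y -> f y = f x) ->
  forall x y, A x -> A y -> f y = f x.
Proof.
move=> cA loc x y Ax Ay.
apply: (@connected_locally_iff _ A (fun z => f z = f x) cA _ x y) => // z Az.
by apply: filterS (loc z Az) => w h Aw; rewrite h.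
Qed.

End LocallyConstant.

(** * Angles of plane vectors *)
Section Plane.
Variable R : realType.
Implicit Types (z m e : R * R) (t : R).

Definition dot m z : R := m.1 * z.1 + m.2 * z.2.
Definition cross m z : R := m.1 * z.2 - m.2 * z.1.

(** [t] is an argument of the complex number [z]. *)
Definition polar z t :=
  exists2 r : R, 0 < r & z = (r * cos t, r * sin t).

(** Rotating by [- t] brings [z] into the right half plane, where [atan] of the
    slope is an argument. *)
Lemma polar_atan z t : 0 < dot (cos t, sin t) z ->
  polar z (t + atan (cross (cos t, sin t) z / dot (cos t, sin t) z)).
Proof.
set X := dot _ _; set Y := cross _ _ => X0.
have tanE := atanK (Y / X).
set a := atan _ in tanE *.
have ca : 0 < cos a by rewrite cos_gt0_pihalf// atan_gtNpi2 atan_ltpi2.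
have sa : sin a = Y / X * cos a by rewrite -tanE /tan divfK// gt_eqF.
exists (X / cos a); first by rewrite divr_gt0.
have z1 : z.1 = cos t * X - sin t * Y.
  rewrite /X /Y /dot /cross /= -[LHS]mul1r -(cos2Dsin2 t); ring.
have z2 : z.2 = sin t * X + cos t * Y.
  rewrite /X /Y /dot /cross /= -[LHS]mul1r -(cos2Dsin2 t); ring.
have zE : z = (z.1, z.2) by case: (z).
rewrite zE z1 z2 cosD sinD sa; congr pair; field;
  by rewrite ?gt_eqF.
Qed.

(** One of the four axis directions makes an acute angle with [z]. *)
Lemma polar_cardinal z : z <> 0 ->
  exists t, 0 < dot (cos t, sin t) z.
Proof.
move=> z0; have [z1|z1|z1] := ltgtP z.1 0.
- by exists pi; rewrite /dot /= cospi sinpi; lra.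
- by exists 0; rewrite /dot /= cos0 sin0; lra.
- have [z2|z2|z2] := ltgtP z.2 0.
  + by exists (- (pi / 2)); rewrite /dot /= cosN sinN cos_pihalf sin_pihalf; lra.
  + by exists (pi / 2); rewrite /dot /= cos_pihalf sin_pihalf; lra.
  + by case: z0; case: z z1 z2 => ? ? /= -> ->.
Qed.

Lemma polar_shift z t t' : polar z t -> polar z t' ->
  cos (t - t') = 1 /\ sin (t - t') = 0.
Proof.
move=> [r r0 ->] [r' r'0 [h1 h2]].
have c := cos2Dsin2 t; have c' := cos2Dsin2 t'.
have rr' : r = r'.
  apply/eqP; rewrite -(@eqrXn2 _ 2)//; [|exact: ltW|exact: ltW].
  rewrite -[X in X == _]mulr1 -[X in _ == X]mulr1 -{1}c -c'.
  by apply/eqP; rewrite !mulrDr -!exprMn h1 h2.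
rewrite -rr' in h1 h2.
have r_neq0 : r != 0 by rewrite gt_eqF.
move/(mulfI r_neq0) : h1 => h1; move/(mulfI r_neq0) : h2 => h2.
rewrite cosB sinB h1 h2; split; last by ring.
by rewrite -!expr2.
Qed.

Lemma polar_add z t t' : polar z t -> cos t' = 1 -> sin t' = 0 ->
  polar z (t + t').
Proof.
move=> [r r0 ->] c s; exists r => //.
by rewrite cosD sinD c s !mulr1 !mulr0 subr0 addr0.
Qed.

(** The pair of [dot z z'] and [cross z' z] is the complex number
    [z * conj z'], whose argument is the difference of the arguments. *)
Lemma polar_sub z z' t t' : polar z t -> polar z' t' ->
  exists2 r : R, 0 < r &
    dot z z' = r * cos (t - t') /\ cross z' z = r * sin (t - t').
Proof.
move=> [r r0 ->] [r' r'0 ->]; exists (r * r'); first by rewrite mulr_gt0.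
by rewrite /dot /cross /= cosB sinB; split; ring.
Qed.

End Plane.

(** * Continuous angle functions and winding numbers *)
Section Winding.
Variable R : realType.
Implicit Types (f : R -> R * R) (m : R * R) (t x y z : R) (k : int).

Lemma continuous_dot f m : continuous f -> continuous (fun u => dot m (f u)).
Proof.
move=> cf u; apply: cvgD; apply: cvgM; try exact: cvg_cst.
- by apply: (cvg_comp f fst (cf u)); exact: cvg_fst.
- by apply: (cvg_comp f snd (cf u)); exact: cvg_snd.
Qed.

Lemma continuous_cross f m : continuous f -> continuous (fun u => cross m (f u)).
Proof.
move=> cf; have -> : (fun u => cross m (f u)) = (fun u => dot (- m.2, m.1) (f u)).
  by apply/funext => u; rewrite /cross /dot /=; ring.
exact: continuous_dot.
Qed.

Lemma trig_periodic t k :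
  cos (t + k%:~R * (pi *+ 2)) = cos t /\ sin (t + k%:~R * (pi *+ 2)) = sin t.
Proof.
have nat_case (n : nat) (s : R) : cos (s + n%:R * (pi *+ 2)) = cos s /\
    sin (s + n%:R * (pi *+ 2)) = sin s.
  by rewrite mulr_natl (periodicn (@cosD2pi R)) (periodicn (@sinD2pi R)).
case: k => n; first exact: nat_case.
have [<- <-] := nat_case n.+1 (t + (Negz n)%:~R * (pi *+ 2)).
have -> : t + (Negz n)%:~R * (pi *+ 2) + n.+1%:R * (pi *+ 2) = t :> R.
  by rewrite NegzE mulrNz; ring.
by [].
Qed.

Lemma trig_trivial t : cos t = 1 -> sin t = 0 ->
  exists k, t = k%:~R * (pi *+ 2).
Proof.
have pi0 := @pi_gt0 R => c1 s0.
pose k := Num.floor (t / (pi *+ 2)); exists k.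
have pp : 0 < pi *+ 2 :> R by lra.
have l1 : k%:~R * (pi *+ 2) <= t by rewrite -ler_pdivlMr// Num.Theory.floor_le.
have l2 : t < (k + 1)%:~R * (pi *+ 2) by rewrite -ltr_pdivrMr// floorD1_gt.
rewrite intrD mulrDl mul1r in l2.
pose r := t + (- k)%:~R * (pi *+ 2).
have [cr sr] := trig_periodic t (- k).
rewrite c1 s0 -/r in cr sr.
have rE : r = t - k%:~R * (pi *+ 2) by rewrite /r mulrNz mulNr.
suff r0 : r = 0 by lra.
have [rpi|rpi|rpi] := ltgtP r pi.
- have [|//] : 0 < r \/ r = 0 by rewrite rE; lra.
  by move=> r0; have := @sin_gt0_pi R r; rewrite sr r0 rpi ltxx => /(_ isT).
- have := @sin_gt0_pi R (r - pi).
  have -> : 0 < r - pi < pi by lra.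
  by move=> /(_ isT); rewrite sinB sinpi cospi sr; lra.
- by move: cr; rewrite rpi cospi; lra.
Qed.

(** The angle function is continuous on the whole line although it measures
    [f] on the interval [[x, y]] alone; this keeps subspace topologies out of
    the statements. *)
Definition lifts f x y (th : R -> R) :=
  continuous th /\ forall u, x <= u <= y -> polar (f u) (th u).

Definition clamp x y u : R := Num.max x (Num.min u y).

Lemma clamp_in x y u : x <= y -> x <= clamp x y u <= y.
Proof. by move=> xy; rewrite /clamp le_max lexx ge_max xy ge_min lexx orbT. Qed.

Lemma clamp_id x y u : x <= u <= y -> clamp x y u = u.
Proof. by move=> /andP[xu uy]; rewrite /clamp (min_idPl uy) (max_idPr xu). Qed.

Lemma continuous_clamp x y : continuous (clamp x y).
Proof.
move=> u; apply: (@continuous_max _ _ (fun=> x) (fun u => Num.min u y)).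
  exact: cvg_cst.
by apply: (@continuous_min _ _ id (fun=> y)); [exact: cvg_id | exact: cvg_cst].
Qed.

(** While [f] stays in an open half plane, the arctangent gives an angle
    function.  Clamping the time makes it continuous outside of the interval
    as well. *)
Lemma lift_half_plane f x y t : x <= y -> continuous f ->
  (forall u, x <= u <= y -> 0 < dot (cos t, sin t) (f u)) ->
  exists th, lifts f x y th.
Proof.
move=> xy cf pos; set m := (cos t, sin t) in pos *.
pose g u := f (clamp x y u).
have cg : continuous g.
  by move=> u; apply: continuous_comp; [exact: continuous_clamp | exact: cf].
exists (fun u => t + atan (cross m (g u) / dot m (g u))); split=> [u|u xuy].
  apply: cvgD; first exact: cvg_cst.
  apply: (@continuous_comp _ _ _ (fun u => cross m (g u) / dot m (g u)) atan);
    last exact: continuous_atan.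
  apply: cvgM; first exact: continuous_cross.
  apply: cvgV; last exact: continuous_dot.
  by rewrite gt_eqF// pos// clamp_in.
by rewrite /g clamp_id//; apply: polar_atan; exact: pos.
Qed.

(** The two angle functions agree at [z] up to a multiple of a full turn, which
    is subtracted from the second one. *)
Lemma lift_glue f x y z th1 th2 : x <= z <= y ->
  lifts f x z th1 -> lifts f z y th2 -> exists th, lifts f x y th.
Proof.
move=> /andP[xz zy] [c1 l1] [c2 l2].
have [c s] : cos (th1 z - th2 z) = 1 /\ sin (th1 z - th2 z) = 0.
  by apply: polar_shift; [apply: l1 | apply: l2]; lra.
exists (fun u => th1 (Num.min u z) + (th2 (Num.max u z) - th2 z)).
split=> [u|u /andP[xu uy]].
  apply: cvgD; last apply: cvgB; last exact: cvg_cst.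
  - apply: (@continuous_comp _ _ _ (fun u => Num.min u z) th1); last exact: c1.
    by apply: (@continuous_min _ _ id (fun=> z)); [exact: cvg_id | exact: cvg_cst].
  - apply: (@continuous_comp _ _ _ (fun u => Num.max u z) th2); last exact: c2.
    by apply: (@continuous_max _ _ id (fun=> z)); [exact: cvg_id | exact: cvg_cst].
have [uz|/ltW zu] := leP u z.
  by rewrite subrr addr0; apply: l1; rewrite xu.
have -> : th1 z + (th2 u - th2 z) = th2 u + (th1 z - th2 z) by ring.
by apply: polar_add => //; apply: l2; rewrite zu.
Qed.

(** The end points [z] for which an angle function exists on [[x, z]] form a set
    which is locally constant in [z], because [f] stays in a half plane near
    each time; and the interval is connected. *)
Lemma lift_exists f x y : x <= y -> continuous f ->
  (forall u, x <= u <= y -> f u <> 0) -> exists th, lifts f x y th.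
Proof.
move=> xy cf f0.
pose P z := exists th, lifts f x z th.
have restrict z z' : z <= z' -> P z' -> P z.
  move=> zz' [th [cth lth]]; exists th; split=> // u /andP[xu uz].
  by apply: lth; rewrite xu (le_trans uz).
have loc z : `[x, y]%classic z ->
    \forall z' \near z, `[x, y]%classic z' -> (P z <-> P z').
  rewrite /= in_itv /= => xzy.
  have [t t0] := polar_cardinal (f0 _ xzy).
  have : \forall z' \near z, 0 < dot (cos t, sin t) (f z').
    exact: (cvgr_gt _ (@continuous_dot f (cos t, sin t) cf z) 0 t0).
  move=> /nbhs_ballP[e /= e0 be].
  have pos w : `|z - w| < e -> 0 < dot (cos t, sin t) (f w) by exact: be.
  apply/nbhs_ballP; exists e => //= z' zz'.
  rewrite /= in_itv /= => xz'y.
  have extend a b : a <= b -> x <= a <= y -> x <= b <= y ->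
      `|z - a| < e -> `|z - b| < e -> P a -> P b.
    move=> ab xa xb za zb [th lth].
    have [|th' lth'] := @lift_half_plane f a b t ab cf.
      move=> u /andP[au ub]; apply: pos; move: za zb.
      by rewrite !ltr_norml; lra.
    by apply: lift_glue lth lth'; lra.
  have zz : `|z - z| < e by rewrite subrr normr0.
  by have [le|/ltW le] := leP z z'; split; [exact: extend|exact: restrict|
    exact: restrict|exact: extend].
have [inx iny] : `[x, y]%classic x /\ `[x, y]%classic y.
  by rewrite /= !in_itv /= !lexx xy.
apply: (connected_locally_iff (@segment_connected _ x y) loc inx iny).
have [t t0] := @polar_cardinal _ (f x) (f0 x inx).
apply: (@lift_half_plane f x x t) => // u; rewrite -eq_le => /eqP <-.
exact: t0.
Qed.

(** A curve that closes up in direction turns a whole number [k] of times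
    around the origin. *)
Definition winds f x y k :=
  exists th, lifts f x y th /\ th y - th x = k%:~R * (pi *+ 2).

Lemma winds_exists f x y : x <= y -> continuous f ->
  (forall u, x <= u <= y -> f u <> 0) -> f x = f y ->
  exists k, winds f x y k.
Proof.
move=> xy cf f0 fxy; have [th lth] := lift_exists xy cf f0.
have [] : cos (th y - th x) = 1 /\ sin (th y - th x) = 0.
  case: lth => _ lth; apply: (@polar_shift R (f y)); last rewrite -fxy;
  by apply: lth; rewrite lexx xy.
by move=> c s; have [k kE] := trig_trivial c s; exists k, th.
Qed.

(** This is the intermediate value theorem: [phi] cannot pass [c]. *)
Lemma stay (phi : R -> R) x y c : x <= y -> continuous phi ->
  (forall u, x <= u <= y -> phi u <> c) -> (phi x < c) = (phi y < c).
Proof.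
move=> xy cphi ne.
have cw : {within `[x, y], continuous phi} by exact: continuous_subspaceT.
have := ne x; have := ne y; rewrite !lexx xy /= => /(_ isT) /eqP ney.
move=> /(_ isT) /eqP nex.
apply/idP/idP => h.
- rewrite ltNge; apply/negP => h'.
  have [|u] := @IVT _ _ _ _ c xy cw.
    by rewrite ge_min le_max (ltW h) h' orbT.
  by rewrite in_itv /= => /ne.
- rewrite ltNge; apply/negP => h'.
  have [|u] := @IVT _ _ _ _ c xy cw.
    by rewrite ge_min le_max (ltW h) h' orbT.
  by rewrite in_itv /= => /ne.
Qed.

End Winding.

(** * Comparing winding numbers around two points *)
Section WindingComparison.
Variable R : realType.
Implicit Types (f : R -> R * R) (m z : R * R) (t x y c : R) (k : int).

(** When [z = g - p] and [z' = g - p'], the number [z * conj z'] is real and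
    nonpositive exactly when [g] lies on the segment from [p] to [p'], and
    real and nonnegative exactly when [g] lies on the rest of the line through
    [p] and [p'].  The two predicates exclude these positions. *)
Definition avoid_neg z z' := cross z' z = 0 -> 0 < dot z z'.
Definition avoid_pos z z' := cross z' z = 0 -> dot z z' < 0.

Lemma turn_floor t c : exists j : int,
  c + j%:~R * (pi *+ 2) <= t < c + j%:~R * (pi *+ 2) + pi *+ 2.
Proof.
have pi0 := @pi_gt0 R.
have pp : 0 < pi *+ 2 :> R by lra.
exists (Num.floor ((t - c) / (pi *+ 2))); set j := Num.floor _.
have l1 : j%:~R * (pi *+ 2) <= t - c by rewrite -ler_pdivlMr// Num.Theory.floor_le.
have : t - c < (j + 1)%:~R * (pi *+ 2) by rewrite -ltr_pdivrMr// floorD1_gt.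
by rewrite intrD mulrDl mul1r; lra.
Qed.

Lemma stay_turn (phi : R -> R) x y c : x <= y -> continuous phi ->
  (forall u k, x <= u <= y -> phi u <> c + k%:~R * (pi *+ 2)) ->
  forall k u, x <= u <= y ->
  (c + k%:~R * (pi *+ 2) < phi x < c + k%:~R * (pi *+ 2) + pi *+ 2) =
  (c + k%:~R * (pi *+ 2) < phi u < c + k%:~R * (pi *+ 2) + pi *+ 2).
Proof.
move=> xy cphi ne k u /andP[xu uy].
have sub v : x <= v <= u -> x <= v <= y by lra.
have s1 := stay xu cphi (fun v h => ne v k (sub v h)).
have s2 := stay xu cphi (fun v h => ne v (k + 1) (sub v h)).
rewrite intrD mulrDl mul1r addrA in s2; rewrite s2.
have neq v : x <= v <= y -> (c + k%:~R * (pi *+ 2) < phi v) =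
    ~~ (phi v < c + k%:~R * (pi *+ 2)).
  move=> /(ne v k) /eqP h; rewrite -leNgt le_eqVlt eq_sym.
  by rewrite (negPf h).
by rewrite !neq ?s1// ?xu ?uy// lexx (le_trans xu uy).
Qed.

Lemma int_turn_eq (d : R) k : d = k%:~R * (pi *+ 2) ->
  - (pi *+ 2) < d < pi *+ 2 -> k = 0.
Proof.
have pi0 := @pi_gt0 R; have pp : 0 < pi *+ 2 :> R by lra.
move=> -> /andP[h1 h2].
have l1 : (- 1)%:~R < k%:~R :> R.
  by rewrite -(ltr_pM2r pp) mulrNz mulN1r.
have l2 : k%:~R < 1%:~R :> R by rewrite -(ltr_pM2r pp) mul1r.
by move: l1 l2; rewrite !ltr_int; lia.
Qed.

Section Compare.
Variables (f f' : R -> R * R) (x y : R) (k k' : int) (th th' : R -> R).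
Hypotheses (lth : lifts f x y th) (lth' : lifts f' x y th').
Let phi u := th u - th' u.

Lemma continuous_angle_diff : continuous phi.
Proof. by move=> u; exact: (cvgB (lth.1 u) (lth'.1 u)). Qed.

Lemma angle_diff u : x <= u <= y -> exists2 r : R, 0 < r &
  dot (f u) (f' u) = r * cos (phi u) /\ cross (f' u) (f u) = r * sin (phi u).
Proof. by move=> xuy; exact: (polar_sub (lth.2 u xuy) (lth'.2 u xuy)). Qed.

Lemma avoid_neg_phase u j : x <= u <= y -> avoid_neg (f u) (f' u) ->
  phi u <> - pi + j%:~R * (pi *+ 2).
Proof.
move=> xuy av e; have [r r0 [dE cE]] := angle_diff xuy.
have [] := @trig_periodic R (- pi) j; rewrite -e cosN sinN cospi sinpi => cp sp.
have := av; rewrite /avoid_neg cE dE sp cp oppr0 mulr0 => /(_ erefl); lra.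
Qed.

Lemma avoid_pos_phase u j : x <= u <= y -> avoid_pos (f u) (f' u) ->
  phi u <> 0 + j%:~R * (pi *+ 2).
Proof.
move=> xuy av e; have [r r0 [dE cE]] := angle_diff xuy.
have [] := @trig_periodic R 0 j; rewrite -e cos0 sin0 => cp sp.
have := av; rewrite /avoid_pos cE dE sp cp mulr0 => /(_ erefl); lra.
Qed.

Lemma cross_gt0_phase u j : x <= u <= y -> 0 < cross (f' u) (f u) ->
  0 + j%:~R * (pi *+ 2) <= phi u < 0 + j%:~R * (pi *+ 2) + pi *+ 2 ->
  j%:~R * (pi *+ 2) < phi u < j%:~R * (pi *+ 2) + pi.
Proof.
move=> xuy c0 hj; have [r r0 [dE cE]] := angle_diff xuy.
have s0 : 0 < sin (phi u) by rewrite -(pmulr_rgt0 _ r0) -cE.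
have [_ sE] := @trig_periodic R (phi u) (- j).
have rE : phi u + (- j)%:~R * (pi *+ 2) = phi u - j%:~R * (pi *+ 2).
  by rewrite mulrNz mulNr.
rewrite rE in sE; set r0' := phi u - _ in sE.
have := @sin_ge0_pi R (r0' - pi); rewrite sinB sinpi cospi sE.
have [r00|r00] := eqVneq r0' 0.
  by move: sE; rewrite r00 sin0; lra.
by move/eqP: r00; rewrite /r0'; lra.
Qed.

Lemma cross_lt0_phase u j : x <= u <= y -> cross (f' u) (f u) < 0 ->
  0 + j%:~R * (pi *+ 2) <= phi u < 0 + j%:~R * (pi *+ 2) + pi *+ 2 ->
  j%:~R * (pi *+ 2) + pi < phi u < j%:~R * (pi *+ 2) + pi *+ 2.
Proof.
move=> xuy c0 hj; have [r r0 [dE cE]] := angle_diff xuy.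
have s0 : sin (phi u) < 0 by rewrite -(pmulr_rlt0 _ r0) -cE.
have [_ sE] := @trig_periodic R (phi u) (- j).
have rE : phi u + (- j)%:~R * (pi *+ 2) = phi u - j%:~R * (pi *+ 2).
  by rewrite mulrNz mulNr.
rewrite rE in sE; set r0' := phi u - _ in sE.
by have := @sin_ge0_pi R r0'; rewrite sE /r0'; lra.
Qed.

End Compare.

(** If the curve does not meet the segment between the two points, then the
    difference of the angles stays inside one turn, so its increment, a
    multiple of a full turn, is zero. *)
Lemma winds_eq f f' x y k k' : x <= y -> winds f x y k -> winds f' x y k' ->
  (forall u, x <= u <= y -> avoid_neg (f u) (f' u)) -> k = k'.
Proof.
move=> xy [th [lth thE]] [th' [lth' th'E]] av.
have pi0 := @pi_gt0 R.
have [j hj] := turn_floor (th x - th' x) (- pi).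
have ne u i : x <= u <= y -> th u - th' u <> - pi + i%:~R * (pi *+ 2).
  by move=> xuy; exact: (avoid_neg_phase lth lth' xuy (av u xuy)).
have cphi := continuous_angle_diff lth lth'.
have xxy : x <= x <= y by rewrite lexx.
have yxy : x <= y <= y by rewrite lexx xy.
have hx : - pi + j%:~R * (pi *+ 2) < th x - th' x <
    - pi + j%:~R * (pi *+ 2) + pi *+ 2.
  by have /eqP := ne x j xxy; lra.
have := hx; rewrite (stay_turn xy cphi ne j yxy) => hy.
apply/eqP; rewrite -subr_eq0; apply/eqP.
apply: (@int_turn_eq ((th y - th' y) - (th x - th' x))).
  by rewrite intrB mulrBl -thE -th'E; ring.
by lra.
Qed.

(** Between the times [s1] and [s2] the curve crosses the line through the two
    points inside the segment, and it does not meet the segment at other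
    times.  Modulo a full turn, the difference of the angles goes from below
    [pi] to above [pi] in between, so it gains exactly one turn. *)
Lemma winds_cross f f' x y s1 s2 k k' : x <= s1 -> s1 <= s2 -> s2 <= y ->
  winds f x y k -> winds f' x y k' ->
  (forall u, x <= u <= s1 -> avoid_neg (f u) (f' u)) ->
  (forall u, s2 <= u <= y -> avoid_neg (f u) (f' u)) ->
  (forall u, s1 <= u <= s2 -> avoid_pos (f u) (f' u)) ->
  0 < cross (f' s1) (f s1) -> cross (f' s2) (f s2) < 0 ->
  k = k' + 1.
Proof.
move=> xs1 s12 s2y [th [lth thE]] [th' [lth' th'E]] av1 av2 av c1 c2.
have pi0 := @pi_gt0 R.
have cphi := continuous_angle_diff lth lth'.
have [j hj] := turn_floor (th s1 - th' s1) 0.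
have in1 u : x <= u <= s1 -> x <= u <= y by lra.
have in2 u : s2 <= u <= y -> x <= u <= y by lra.
have inm u : s1 <= u <= s2 -> x <= u <= y by lra.
have xs1y : x <= s1 <= y by lra.
have xs2y : x <= s2 <= y by lra.
have h1 := cross_gt0_phase lth lth' xs1y c1 hj.
have h2 : 0 + j%:~R * (pi *+ 2) <= th s2 - th' s2 <
    0 + j%:~R * (pi *+ 2) + pi *+ 2.
  have nem u i : s1 <= u <= s2 -> th u - th' u <> 0 + i%:~R * (pi *+ 2).
    by move=> h; exact: (avoid_pos_phase lth lth' (inm u h) (av u h)).
  have s2s : s1 <= s2 <= s2 by lra.
  have := stay_turn s12 cphi nem j s2s.
  have -> : 0 + j%:~R * (pi *+ 2) < th s1 - th' s1 <
    0 + j%:~R * (pi *+ 2) + pi *+ 2 by lra.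
  by move=> /esym; lra.
have {}h2 := cross_lt0_phase lth lth' xs2y c2 h2.
have hx : - pi + j%:~R * (pi *+ 2) < th x - th' x <
    - pi + j%:~R * (pi *+ 2) + pi *+ 2.
  have nem u i : x <= u <= s1 -> th u - th' u <> - pi + i%:~R * (pi *+ 2).
    by move=> h; exact: (avoid_neg_phase lth lth' (in1 u h) (av1 u h)).
  have s1s : x <= s1 <= s1 by lra.
  by rewrite (stay_turn xs1 cphi nem j s1s); lra.
have hy : - pi + (j + 1)%:~R * (pi *+ 2) < th y - th' y <
    - pi + (j + 1)%:~R * (pi *+ 2) + pi *+ 2.
  have nem u i : s2 <= u <= y -> th u - th' u <> - pi + i%:~R * (pi *+ 2).
    by move=> h; exact: (avoid_neg_phase lth lth' (in2 u h) (av2 u h)).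
  have ys : s2 <= y <= y by lra.
  rewrite -(stay_turn s2y cphi nem (j + 1) ys) intrD mulrDl mul1r; lra.
rewrite intrD mulrDl mul1r in hy.
apply/eqP; rewrite -subr_eq0; apply/eqP.
apply: (@int_turn_eq ((th y - th' y) - (th x - th' x) - pi *+ 2)).
  by rewrite intrB intrD mulrBl mulrDl mul1r -thE -th'E; ring.
by lra.
Qed.

End WindingComparison.

(** * One-sided tangent directions *)
Section Rays.
Variable R : realType.
Implicit Types (c p : R -> R * R) (m z v w d e : R * R) (t u x y : R).

Lemma dotB m z w : dot m (z - w) = dot m z - dot m w.
Proof. by rewrite /dot /=; ring. Qed.

Lemma dotZ m t z : dot m (t *: z) = t * dot m z.
Proof. by rewrite /dot /= /GRing.scale /=; ring. Qed.

Lemma functional_exists d d' (a b : R) : cross d d' != 0 ->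
  exists m, dot m d = a /\ dot m d' = b.
Proof.
move=> K0; exists ((a * d'.2 - b * d.2) / cross d d',
                   (b * d.1 - a * d'.1) / cross d d').
by rewrite /dot /=; split; move: K0; rewrite /cross => K0; field.
Qed.

(** This expresses [z] in the orthogonal basis formed by [z'] and its rotation
    by a right angle. *)
Lemma project_dot m z z' :
  dot z' z' * dot m z = dot z z' * dot m z' + cross z' z * cross z' m.
Proof. by rewrite /dot /cross /=; ring. Qed.

Lemma dot_sqr_gt0 m z : dot m z != 0 -> 0 < dot z z.
Proof.
move=> mz; have : dot z z = z.1 ^+ 2 + z.2 ^+ 2 by rewrite /dot; ring.
move=> ->; rewrite lt_def addr_ge0 ?sqr_ge0// andbT.
rewrite paddr_eq0 ?sqr_ge0// !sqrf_eq0; apply: contra mz.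
by move=> /andP[/eqP z1 /eqP z2]; rewrite /dot z1 z2 !mulr0 addr0.
Qed.

(** Two vectors in an open half plane do not point in opposite directions. *)
Lemma half_plane_avoid_neg m z z' : 0 < dot m z -> 0 < dot m z' ->
  avoid_neg z z'.
Proof.
move=> mz mz' c0; have := project_dot m z z'; rewrite c0 mul0r addr0 => e.
have zz : 0 < dot z' z' by apply: (@dot_sqr_gt0 m); rewrite gt_eqF.
by rewrite -(pmulr_lgt0 _ mz') -e mulr_gt0.
Qed.

Lemma half_plane_avoid_neg_opp m z z' : dot m z < 0 -> dot m z' < 0 ->
  avoid_neg z z'.
Proof.
move=> mz mz'; apply: (@half_plane_avoid_neg (- m));
  move: mz mz'; rewrite /dot /=; lra.
Qed.

(** If [z = k z'] with [k >= 0], then the conditions on [n] force [1 < k], and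
    those on [n'] force [k < 1]. *)
Lemma wedge_avoid_pos n n' z z' : 0 < dot n z -> dot n z' < dot n z ->
  0 < dot n' z' -> dot n' z < dot n' z' -> avoid_pos z z'.
Proof.
move=> nz nzz' n'z' n'zz' c0.
have := project_dot n z z'; have := project_dot n' z z'.
rewrite c0 !mul0r !addr0 => e' e.
have zz : 0 < dot z' z' by apply: (@dot_sqr_gt0 n'); rewrite gt_eqF.
rewrite ltNge; apply/negP => D0.
have h1 : dot z' z' < dot z z'.
  have D1 : 0 < dot z z'.
    rewrite lt_def D0 andbT; apply/eqP => D1; move: e; rewrite D1 mul0r => /eqP.
    by rewrite mulf_eq0 !gt_eqF.
  by rewrite -(ltr_pM2r nz) e ltr_pM2l.
by have := ltr_pM2l zz (dot n' z) (dot n' z');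
  rewrite n'zz' e' (ltr_pM2r n'z') => h2; move: (lt_trans h1 h2); rewrite ltxx.
Qed.

(** The path [c] leaves [v], as [t] decreases to [0], in the direction [e].  Both
    the half-branches of the curve at a crossing and the paths into the corners
    are of this kind. *)
Definition ray c v e := (fun t => t^-1 *: (c t - v)) @ 0^'+ --> e.

Lemma cvg_dot (T : Type) (F : set_system T) {FF : Filter F} (f : T -> R * R) m z :
  f @ F --> z -> (fun i => dot m (f i)) @ F --> dot m z.
Proof.
move=> cf; apply: cvgD; apply: cvgM; try exact: cvg_cst.
- by apply: (cvg_comp f fst cf); exact: cvg_fst.
- by apply: (cvg_comp f snd cf); exact: cvg_snd.
Qed.

Lemma cvg_cross (T : Type) (F : set_system T) {FF : Filter F}
    (f g : T -> R * R) z w :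
  f @ F --> z -> g @ F --> w -> (fun i => cross (f i) (g i)) @ F --> cross z w.
Proof.
move=> cf cg; apply: cvgB; apply: cvgM.
- by apply: (cvg_comp f fst cf); exact: cvg_fst.
- by apply: (cvg_comp g snd cg); exact: cvg_snd.
- by apply: (cvg_comp f snd cf); exact: cvg_snd.
- by apply: (cvg_comp g fst cg); exact: cvg_fst.
Qed.

Lemma ray_gt0 c v e m : ray c v e -> 0 < dot m e ->
  \forall t \near 0^'+, 0 < dot m (c t - v).
Proof.
move=> rc me.
have h : \forall t \near (0:R)^'+, 0 < dot m (t^-1 *: (c t - v)).
  have cm : (fun t => dot m (t^-1 *: (c t - v))) @ 0^'+ --> dot m e.
    exact: cvg_dot.
  exact: (cvgr_gt _ cm 0 me).
near=> t; have t0 : 0 < t by near: t; exact: nbhs_right_gt.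
have : 0 < dot m (t^-1 *: (c t - v)) by near: t.
by rewrite dotZ pmulr_rgt0 ?invr_gt0.
Unshelve. all: by end_near. Qed.

Lemma ray_lt0 c v e m : ray c v e -> dot m e < 0 ->
  \forall t \near 0^'+, dot m (c t - v) < 0.
Proof.
move=> rc me; have me' : 0 < dot (- m) e by move: me; rewrite /dot /=; lra.
by apply: filterS (ray_gt0 rc me') => t; rewrite /dot /=; lra.
Qed.

Lemma rayB c c' v v' e e' : ray c v e -> ray c' v' e' ->
  ray (fun t => c t - c' t) (v - v') (e - e').
Proof.
move=> r r'; rewrite /ray.
rewrite (_ : (fun t => _) =
    (fun t => t^-1 *: (c t - v) - t^-1 *: (c' t - v'))); first exact: cvgB.
apply/funext => t; rewrite -scalerBr; congr (_ *: _).
rewrite !opprB -!addrA; congr (_ + _); rewrite addrCA [RHS]addrCA.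
by congr (_ + _); rewrite addrC.
Qed.

Lemma ray_cvg c v e : ray c v e -> c @ 0^'+ --> v.
Proof.
move=> r.
have : (fun t => t *: (t^-1 *: (c t - v)) + v) @ 0^'+ --> (0 : R) *: e + v.
  apply: cvgD; last exact: cvg_cst.
  apply: cvgZ => //.
  by apply: cvg_at_right_filter; exact: cvg_id.
rewrite scale0r add0r; apply: cvg_trans; apply: near_eq_cvg.
near=> t; have t0 : 0 < t by near: t; exact: nbhs_right_gt.
by rewrite scalerA divff ?gt_eqF// scale1r subrK.
Unshelve. all: by end_near. Qed.

End Rays.

(** * The curve near a crossing and the segment between two corners *)
Section LocalCrossing.
Variable R : realType.
Implicit Types (c p : R -> R * R) (m z v w d e : R * R) (t u x y h : R).

(** Points close to [v] are all on the same side of a line that separates them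
    from [g u]. *)
Lemma far_avoid (T : Type) (F : set_system T) {FF : Filter F}
    (g : R -> R * R) (q q' : T -> R * R) v u :
  continuous g -> g u <> v -> q @ F --> v -> q' @ F --> v ->
  \forall u' \near u & i \near F, avoid_neg (g u' - q i) (g u' - q' i).
Proof.
move=> cg guv cq cq'; pose m := g u - v.
have m0 : 0 < dot m m.
  have [m0|] := eqVneq (dot m m) 0; last exact: dot_sqr_gt0.
  case: guv; apply/eqP; rewrite -subr_eq0 -/m; move: m0; rewrite /dot.
  move/eqP; rewrite -!expr2 paddr_eq0 ?sqr_ge0// !sqrf_eq0.
  by case: m => a b /= /andP[/eqP -> /eqP ->].
pose eps := dot m m / 2.
have e0 : 0 < eps by rewrite divr_gt0.
have bnd (r : T -> R * R) : r @ F --> v ->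
    \forall i \near F, dot m (r i) < dot m v + eps.
  move=> cr; have cm : (fun i => dot m (r i)) @ F --> dot m v by exact: cvg_dot.
  by apply: (cvgr_lt _ cm); rewrite ltrDl.
have bg : \forall u' \near u, dot m v + eps < dot m (g u').
  apply: (cvgr_gt _ (@continuous_dot _ g m cg u)).
  have : dot m (g u) = dot m v + dot m (g u - v) by rewrite dotB; ring.
  by rewrite -/m /eps; lra.
near=> u' i.
have h1 : dot m v + eps < dot m (g u') by near: u'.
have h2 : dot m (q i) < dot m v + eps by near: i; exact: bnd cq.
have h3 : dot m (q' i) < dot m v + eps by near: i; exact: bnd cq'.
by apply: (@half_plane_avoid_neg _ m); rewrite dotB subr_gt0;
  [exact: lt_trans h2 h1 | exact: lt_trans h3 h1].
Unshelve. all: by end_near. Qed.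

(** The branch of [g] through time [u], followed forwards when [s = 1] and
    backwards when [s = - 1]. *)
Definition half_branch (g : R -> R * R) u s : R -> R * R :=
  fun t => g (u + s * t).

Lemma near_half_branch (P : R * R -> Prop) (g : R -> R * R) u s :
  s * s = 1 -> P (g u) -> (\forall t \near 0^'+, P (half_branch g u s t)) ->
  \forall u' \near u, 0 <= s * (u' - u) -> P (g u').
Proof.
move=> ss Pu /nbhs_ballP[e /= e0 he]; apply/nbhs_ballP; exists e => //= u' uu'.
rewrite le_eqVlt => /orP[/eqP s0|s0].
  suff -> : u' = u by [].
  have : s * (s * (u' - u)) = u' - u by rewrite mulrA ss mul1r.
  by rewrite -s0 mulr0; lra.
have u'E : u + s * (s * (u' - u)) = u' by rewrite mulrA ss mul1r addrC subrK.
have := he (s * (u' - u)); rewrite /half_branch u'E.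
apply=> //; rewrite /ball /= sub0r normrN normrM.
have -> : `|s| = 1.
  by apply/eqP; rewrite -(@eqrXn2 _ 2)// -normrX expr2 ss normr1 expr1n.
by rewrite mul1r distrC.
Qed.

(** The functional [m] is positive on the two corners and nonpositive on the
    half-branch, which is thus disjoint from the segment between the
    corners. *)
Lemma side_avoid (g p p' : R -> R * R) v w w' e u s m : s * s = 1 ->
  g u = v -> ray (half_branch g u s) v e -> dot m e < 0 ->
  ray p v w -> ray p' v w' -> 0 < dot m w -> 0 < dot m w' ->
  \forall u' \near u & h \near 0^'+,
    0 <= s * (u' - u) -> avoid_neg (g u' - p h) (g u' - p' h).
Proof.
move=> ss guv re me rp rp' mw mw'.
have hg : \forall u' \near u, 0 <= s * (u' - u) -> dot m (g u' - v) <= 0.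
  apply: (@near_half_branch (fun z => dot m (z - v) <= 0)) => //.
    by rewrite guv dotB subrr.
  by apply: filterS (ray_lt0 re me) => t /ltW.
near=> u' h.
have h1 : 0 <= s * (u' - u) -> dot m (g u' - v) <= 0 by near: u'.
have h2 : 0 < dot m (p h - v) by near: h; exact: ray_gt0 rp mw.
have h3 : 0 < dot m (p' h - v) by near: h; exact: ray_gt0 rp' mw'.
move=> /h1; move: h2 h3; rewrite !dotB => h2 h3 {}h1.
by apply: (@half_plane_avoid_neg_opp _ m); rewrite dotB; lra.
Unshelve. all: by end_near. Qed.

(** The two corners are in the directions [d + d'] and [d - d'], separated by
    the half-branch of direction [d]; the other three half-branches at the
    crossing leave in these directions. *)
Definition safe d d' e := [\/ e = - d, e = d' | e = - d'].

Lemma safe_avoid (g p p' : R -> R * R) v d d' e u s : s * s = 1 ->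
  cross d d' != 0 ->
  g u = v -> ray (half_branch g u s) v e -> safe d d' e ->
  ray p v (d + d') -> ray p' v (d - d') ->
  \forall u' \near u & h \near 0^'+,
    0 <= s * (u' - u) -> avoid_neg (g u' - p h) (g u' - p' h).
Proof.
move=> ss K0 guv re sf rp rp'.
have [m [m1 m2 m3]] : exists m, [/\ dot m e < 0, 0 < dot m (d + d') &
    0 < dot m (d - d')].
  have dotD m z w : dot m (z + w) = dot m z + dot m w by rewrite /dot /=; ring.
  have dotN m z : dot m (- z) = - dot m z by rewrite /dot /=; ring.
  case: sf => ->.
  - have [m [md md']] := functional_exists 1 0 K0.
    by exists m; rewrite !(dotD, dotN) md md'; split; lra.
  - have [m [md md']] := functional_exists 2 (-1) K0.
    by exists m; rewrite !(dotD, dotN) md md'; split; lra.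
  - have [m [md md']] := functional_exists 2 1 K0.
    by exists m; rewrite !(dotD, dotN) md md'; split; lra.
exact: (side_avoid ss guv re m1 rp rp' m2 m3).
Qed.

Lemma cvg_gt0 (T : Type) (F : set_system T) {FF : Filter F} (f : T -> R) (l : R) :
  f @ F --> l -> 0 < l -> \forall i \near F, 0 < f i.
Proof. by move=> cf l0; exact: (cvgr_gt _ cf). Qed.

(** In the basis [(d, d')], a half-branch of direction [d] stays in the cone
    where the second coordinate is at most half of the first one in absolute
    value.  The functionals [n] and [n'] that define this cone are negative at
    one corner each, and keep decreasing on the line through the corners beyond
    this corner.  So the half-branch can meet this line only between the
    corners.  It starts on one side of the line and ends on the other one. *)
Lemma crossing_half_branch c p p' v d d' :
  cross d d' != 0 -> c 0 = v -> ray c v d ->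
  ray p v (d + d') -> ray p' v (d - d') ->
  exists2 e : R, 0 < e & forall t, 0 < t < e -> \forall h \near 0^'+,
    [/\ forall t', 0 <= t' <= t -> avoid_pos (c t' - p h) (c t' - p' h),
        0 < cross d d' * cross (c 0 - p' h) (c 0 - p h) &
        cross d d' * cross (c t - p' h) (c t - p h) < 0].
Proof.
move=> K0 c0 rc rp rp'.
have dotD m z w : dot m (z + w) = dot m z + dot m w by rewrite /dot /=; ring.
have [n [nd nd']] := functional_exists 1 (-2) K0.
have [n' [n'd n'd']] := functional_exists 1 2 K0.
(* [k] tells on which side of the line through [v] of direction [d'] a point is,
   with a sign that makes it positive at [d]. *)
pose k := (cross d d' * d'.2, - (cross d d' * d'.1)).
have kE z : dot k z = cross d d' * cross z d' by rewrite /k /dot /cross /=; ring.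
have KK : 0 < cross d d' * cross d d' by rewrite -expr2 exprn_even_gt0.
have kd : 0 < dot k d by rewrite kE.
have [e e0 he] : exists2 e : R, 0 < e & forall t, 0 < t < e ->
    [/\ 0 < dot n (c t - v), 0 < dot n' (c t - v) & 0 < dot k (c t - v)].
  have : \forall t \near 0^'+,
      [/\ 0 < dot n (c t - v), 0 < dot n' (c t - v) & 0 < dot k (c t - v)].
    near=> t; split; near: t; apply: (ray_gt0 rc) => //.
    - by rewrite nd.
    - by rewrite n'd.
  move=> /nbhs_ballP[e /= e0 he]; exists e => // t /andP[t0 te].
  by apply: he => //; rewrite /ball /= sub0r normrN gtr0_norm.
exists e => // t /andP[t0 te].
have rpp' : ray (fun h => p h - p' h) 0 (2 *: d').
  have := rayB rp rp'; rewrite subrr opprB addrC addrA -(addrA _ (- d)).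
  by rewrite addNr addr0 scaler_nat mulr2n.
have n1 : \forall h \near 0^'+, dot n (p h - v) < 0.
  by apply: (ray_lt0 rp); rewrite dotD nd nd'; lra.
have n2 : \forall h \near 0^'+, dot n (p h - p' h - 0) < 0.
  by apply: (ray_lt0 rpp'); rewrite dotZ nd'; lra.
have n3 : \forall h \near 0^'+, dot n' (p' h - v) < 0.
  by apply: (ray_lt0 rp'); rewrite dotB n'd n'd'; lra.
have n4 : \forall h \near 0^'+, 0 < dot n' (p h - p' h - 0).
  by apply: (ray_gt0 rpp'); rewrite dotZ n'd'; lra.
have s0 : \forall h \near 0^'+,
    0 < cross d d' * cross (h^-1 *: (p' h - v)) (h^-1 *: (p h - v)).
  apply: (@cvg_gt0 _ _ _ _ (cross d d' * cross (d - d') (d + d'))).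
    by apply: cvgM; [exact: cvg_cst | exact: cvg_cross].
  have -> : cross (d - d') (d + d') = 2 * cross d d'.
    by rewrite /cross /=; ring.
  by rewrite mulrCA mulr_gt0.
have st : \forall h \near 0^'+,
    0 < cross d d' * cross (c t - p' h) (h^-1 *: (p h - p' h - 0)).
  apply: (@cvg_gt0 _ _ _ _ (cross d d' * cross (c t - v) (2 *: d'))).
    apply: cvgM; first exact: cvg_cst.
    by apply: cvg_cross => //; apply: cvgB; [exact: cvg_cst | exact: ray_cvg rp'].
  have := he t; rewrite t0 te => /(_ isT) [_ _].
  rewrite kE; have -> : cross (c t - v) (2 *: d') = 2 * cross (c t - v) d'.
    by rewrite /cross /= /GRing.scale /=; ring.
  by rewrite mulrCA => h; rewrite mulr_gt0.
near=> h; have h0 : 0 < h by near: h; exact: nbhs_right_gt.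
have hn1 : dot n (p h - v) < 0 by near: h.
have hn2 : dot n (p h - p' h - 0) < 0 by near: h.
have hn3 : dot n' (p' h - v) < 0 by near: h.
have hn4 : 0 < dot n' (p h - p' h - 0) by near: h.
have hs0 : 0 < cross d d' * cross (h^-1 *: (p' h - v)) (h^-1 *: (p h - v)).
  by near: h.
have hst : 0 < cross d d' * cross (c t - p' h) (h^-1 *: (p h - p' h - 0)).
  by near: h.
rewrite !subr0 in hn2 hn4 hst; rewrite !dotB in hn1 hn2 hn3 hn4.
split.
- move=> t' /andP[t'0 t't].
  have [ct1 ct2] : 0 <= dot n (c t' - v) /\ 0 <= dot n' (c t' - v).
    move: t'0; rewrite le_eqVlt => /orP[/eqP <-|t'0].
      by rewrite c0 !dotB !subrr.
    have [|/ltW ? /ltW ? _ //] := he t'.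
    by rewrite t'0 (le_lt_trans t't).
  rewrite !dotB in ct1 ct2.
  by apply: (@wedge_avoid_pos _ n n'); rewrite !dotB; lra.
- move: hs0; rewrite c0.
  have -> : cross (h^-1 *: (p' h - v)) (h^-1 *: (p h - v)) =
      h^-1 ^+ 2 * cross (v - p' h) (v - p h).
    by rewrite /cross /= /GRing.scale /=; ring.
  by rewrite mulrCA pmulr_rgt0// exprn_gt0// invr_gt0.
- move: hst.
  have -> : cross (c t - p' h) (h^-1 *: (p h - p' h)) =
      - (h^-1 * cross (c t - p' h) (c t - p h)).
    by rewrite /cross /= /GRing.scale /=; ring.
  by rewrite mulrN mulrCA oppr_gt0 pmulr_rlt0// invr_gt0.
Unshelve. all: by end_near. Qed.

Lemma segment_near (T : Type) (F : set_system T) {FF : Filter F}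
    (P : T -> R -> Prop) x y :
  (forall u, x <= u <= y -> \forall u' \near u & i \near F, P i u') ->
  \forall i \near F, forall u, x <= u <= y -> P i u.
Proof.
move=> loc.
have /compact_near_coveringP cov := @segment_compact R x y.
apply: filterS (cov T F P _ _) => [i sub u xuy|u].
  by apply: sub; rewrite /= in_itv.
by rewrite /= in_itv; exact: loc.
Qed.

End LocalCrossing.

(** * Jumps of the winding number between adjacent corners *)
Section Jump.
Variable R : realType.
Implicit Types (u x y s h : R) (k : int).

Lemma dotC (z z' : R * R) : dot z z' = dot z' z.
Proof. by rewrite /dot; ring. Qed.

Lemma crossC (z z' : R * R) : cross z z' = - cross z' z.
Proof. by rewrite /cross; ring. Qed.

Lemma avoid_neg_sym (z z' : R * R) : avoid_neg z z' -> avoid_neg z' z.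
Proof. by move=> av c0; rewrite dotC; apply: av; rewrite crossC c0 oppr0. Qed.

Lemma avoid_pos_sym (z z' : R * R) : avoid_pos z z' -> avoid_pos z' z.
Proof. by move=> av c0; rewrite dotC; apply: av; rewrite crossC c0 oppr0. Qed.

Lemma avoid_neg_neq0 (z z' : R * R) : avoid_neg z z' -> z <> 0 /\ z' <> 0.
Proof.
move=> av; split=> z0; move: av; rewrite /avoid_neg /cross /dot z0 /=;
  by rewrite ?(mul0r, mulr0) subr0 addr0 ltxx => /(_ erefl).
Qed.

Lemma avoid_pos_neq0 (z z' : R * R) : avoid_pos z z' -> z <> 0 /\ z' <> 0.
Proof.
move=> av; split=> z0; move: av; rewrite /avoid_pos /cross /dot z0 /=;
  by rewrite ?(mul0r, mulr0) subr0 addr0 ltxx => /(_ erefl).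
Qed.

Variables (g : R -> R * R) (v d d' : R * R) (p p' : R -> R * R).
Hypotheses (cg : continuous g) (K0 : cross d d' != 0).
Hypotheses (rp : ray p v (d + d')) (rp' : ray p' v (d - d')).

Definition half_safe u s :=
  exists2 e, ray (half_branch g u s) v e & safe d d' e.

(** Both corners are on the same side of the line through [v] of direction
    [d']. *)
Lemma center_avoid : \forall h \near 0^'+, avoid_neg (v - p h) (v - p' h).
Proof.
have dotD m z w : dot m (z + w) = dot m z + dot m w :> R by rewrite /dot /=; ring.
have [m [md md']] := functional_exists 1 0 K0.
have mw : 0 < dot m (d + d') by rewrite dotD md md' addr0.
have mw' : 0 < dot m (d - d') by rewrite dotB md md' subr0.
near=> h.
have h1 : 0 < dot m (p h - v) by near: h; exact: ray_gt0 rp mw.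
have h2 : 0 < dot m (p' h - v) by near: h; exact: ray_gt0 rp' mw'.
rewrite !dotB in h1 h2.
by apply: (@half_plane_avoid_neg_opp _ m); rewrite dotB; lra.
Unshelve. all: by end_near. Qed.

(** The set [A] of times is chosen so as to leave out the short arc that does
    cross the segment: near its boundary, only one of the two half-branches has
    to be safe. *)
Lemma segment_avoid (A : R -> Prop) x y :
  (forall u s, x <= u <= y -> g u = v -> s = 1 \/ s = -1 -> half_safe u s \/
     \forall u' \near u, A u' -> 0 < s * (u' - u) -> False) ->
  \forall h \near 0^'+, forall u, x <= u <= y -> A u ->
    avoid_neg (g u - p h) (g u - p' h).
Proof.
move=> hA; apply: (@segment_near _ _ _ _ (fun h u =>
  A u -> avoid_neg (g u - p h) (g u - p' h))) => u xuy.
have [guv|guv] := EM (g u = v); last first.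
  have av : \forall u' \near u & h \near 0^'+,
      avoid_neg (g u' - p h) (g u' - p' h).
    exact: (far_avoid cg guv (ray_cvg rp) (ray_cvg rp')).
  by apply: filterS av => -[u' h] /= av _.
have side s : s = 1 \/ s = -1 -> \forall u' \near u & h \near 0^'+,
    A u' -> 0 < s * (u' - u) -> avoid_neg (g u' - p h) (g u' - p' h).
  move=> s1; have [[e re sf]|ex] := hA u s xuy guv s1.
    have ss : s * s = 1 by case: s1 => ->; rewrite ?mulrNN mulr1.
    have := safe_avoid ss K0 guv re sf rp rp'.
    by apply: filterS => -[u' h] /= av _ /ltW.
  near=> u' h.
  have : A u' -> 0 < s * (u' - u) -> False by near: u'.
  by move=> no Au' su'; case: (no Au' su').
have mid : \forall u' \near u & h \near 0^'+, u' = u ->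
    avoid_neg (g u' - p h) (g u' - p' h).
  near=> u' h.
  have ca : avoid_neg (v - p h) (v - p' h) by near: h; exact: center_avoid.
  by move=> ->; rewrite guv.
have right := side 1 (or_introl erefl).
have left := side (-1) (or_intror erefl).
apply: filterS3 right mid left => -[u' h] /= r m l Au'.
have [lt|lt|e] := ltgtP u' u; last exact: m.
- by apply: l => //; lra.
- by apply: r => //; lra.
Unshelve. all: by end_near. Qed.

(** The end points of the time interval need one half-branch only. *)
Lemma no_jump x y : x <= y ->
  (forall u, x <= u <= y -> g u = v ->
     (u < y -> half_safe u 1) /\ (x < u -> half_safe u (-1))) ->
  \forall h \near 0^'+, forall k k',
    winds (fun u => g u - p h) x y k -> winds (fun u => g u - p' h) x y k' ->
    k = k'.
Proof.
move=> xy hs.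
have cond u s : x <= u <= y -> g u = v -> s = 1 \/ s = -1 -> half_safe u s \/
    \forall u' \near u, x <= u' <= y -> 0 < s * (u' - u) -> False.
  move=> xuy guv; have [h1 h2] := hs u xuy guv; case=> ->.
  - have [|yu] := ltP u y; first by left; exact: h1.
    by right; apply: (@nearW _ (nbhs u)) => u'; lra.
  - have [|ux] := ltP x u; first by left; exact: h2.
    by right; apply: (@nearW _ (nbhs u)) => u'; lra.
apply: (@filterS _ 0^'+ _ _ _ _ (segment_avoid cond)) => h av k k' w w'.
by apply: (winds_eq xy w w') => u xuy; exact: av.
Qed.

(** The curve crosses the segment between the corners shortly after the time
    [s].  The case [x = s] of a loop that starts at the crossing is included,
    so that the jump is the same for the whole curve and for its subarcs. *)
Lemma jump_forward x y s : x <= s < y -> g s = v ->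
  ray (half_branch g s 1) v d ->
  (forall u, x <= u <= y -> g u = v ->
     (u < y -> u <> s -> half_safe u 1) /\ (x < u -> half_safe u (-1))) ->
  \forall h \near 0^'+,
    (forall u, x <= u <= y -> g u - p h <> 0 /\ g u - p' h <> 0) /\
    forall k k', winds (fun u => g u - p h) x y k ->
      winds (fun u => g u - p' h) x y k' -> k = k' + sgz (cross d d').
Proof.
move=> /andP[xs sy] gsv rs hs.
have c0 : half_branch g s 1 0 = v by rewrite /half_branch mulr0 addr0.
have [e e0 he] := crossing_half_branch K0 c0 rs rp rp'.
pose t := Num.min e (y - s) / 2.
have [t0 te ty] : [/\ 0 < t, t < e & t < y - s].
  have ys : 0 < y - s by lra.
  have m0 : 0 < Num.min e (y - s) by rewrite lt_min e0.
  have me : Num.min e (y - s) <= e by rewrite ge_min lexx.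
  have my : Num.min e (y - s) <= y - s by rewrite ge_min lexx orbT.
  by rewrite /t; split; lra.
have te' : 0 < t < e by rewrite t0.
pose A u := x <= u <= y /\ (u <= s \/ s + t <= u).
have cond u i : x <= u <= y -> g u = v -> i = 1 \/ i = -1 -> half_safe u i \/
    \forall u' \near u, A u' -> 0 < i * (u' - u) -> False.
  move=> xuy guv; have [h1 h2] := hs u xuy guv; case=> ->.
  - have [us|us] := EM (u = s).
      right; have : \forall u' \near u, u' < s + t.
        by apply: lt_nbhsl; rewrite us; lra.
      by apply: filterS => u' u't [_ []]; rewrite us; lra.
    have [|yu] := ltP u y; first by left; exact: h1.
    by right; apply: (@nearW _ (nbhs u)) => u' [xu' _]; lra.
  - have [|ux] := ltP x u; first by left; exact: h2.
    by right; apply: (@nearW _ (nbhs u)) => u' [xu' _]; lra.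
have xs1 := xs; have s12 : s <= s + t by lra.
have s2y : s + t <= y by lra.
apply: (@filterS2 _ 0^'+ _ _ _ _ _ (segment_avoid cond) (he t te')).
move=> h av [avp c1 c2].
rewrite /half_branch !mul1r addr0 in c1 c2.
have a1 u : x <= u <= s -> avoid_neg (g u - p h) (g u - p' h).
  by move=> xus; apply: av; [lra | split; [lra | left; lra]].
have a2 u : s + t <= u <= y -> avoid_neg (g u - p h) (g u - p' h).
  by move=> xus; apply: av; [lra | split; [lra | right; lra]].
have a3 u : s <= u <= s + t -> avoid_pos (g u - p h) (g u - p' h).
  move=> xus; have := avp (u - s); rewrite /half_branch.
  have -> : s + 1 * (u - s) = u by ring.
  by apply; lra.
split.
  move=> u /andP[xu uy].
  have [us|/ltW us] := leP u s; first by apply/avoid_neg_neq0/a1; rewrite xu.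
  have [us2|/ltW us2] := leP u (s + t); first by apply/avoid_pos_neq0/a3; rewrite us.
  by apply/avoid_neg_neq0/a2; rewrite us2.
move=> k k' w w'.
have [Kn|Kp|/eqP] := ltgtP (cross d d') 0; last by rewrite (negPf K0).
- rewrite nmulr_rgt0// in c1; rewrite nmulr_rlt0// in c2.
  rewrite (ltr0_sgz Kn); suff -> : k' = k + 1 by rewrite addrK.
  apply: (winds_cross xs1 s12 s2y w' w).
  + by move=> u /a1/avoid_neg_sym.
  + by move=> u /a2/avoid_neg_sym.
  + by move=> u /a3/avoid_pos_sym.
  + by move: c1; rewrite /cross; lra.
  + by move: c2; rewrite /cross; lra.
- rewrite pmulr_rgt0// in c1; rewrite pmulr_rlt0// in c2.
  by rewrite (gtr0_sgz Kp); exact: (winds_cross xs1 s12 s2y w w' a1 a2 a3).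
Qed.

(** Here the crossing takes place shortly before [s], hence in the direction
    opposite to that of [jump_forward]. *)
Lemma jump_backward x y s : x < s <= y -> g s = v ->
  ray (half_branch g s (-1)) v d ->
  (forall u, x <= u <= y -> g u = v ->
     (u < y -> half_safe u 1) /\ (x < u -> u <> s -> half_safe u (-1))) ->
  \forall h \near 0^'+,
    (forall u, x <= u <= y -> g u - p h <> 0 /\ g u - p' h <> 0) /\
    forall k k', winds (fun u => g u - p h) x y k ->
      winds (fun u => g u - p' h) x y k' -> k' = k + sgz (cross d d').
Proof.
move=> /andP[xs sy] gsv rs hs.
have c0 : half_branch g s (-1) 0 = v by rewrite /half_branch mulr0 addr0.
have [e e0 he] := crossing_half_branch K0 c0 rs rp rp'.
pose t := Num.min e (s - x) / 2.
have [t0 te ty] : [/\ 0 < t, t < e & t < s - x].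
  have ys : 0 < s - x by lra.
  have m0 : 0 < Num.min e (s - x) by rewrite lt_min e0.
  have me : Num.min e (s - x) <= e by rewrite ge_min lexx.
  have my : Num.min e (s - x) <= s - x by rewrite ge_min lexx orbT.
  by rewrite /t; split; lra.
have te' : 0 < t < e by rewrite t0.
pose A u := x <= u <= y /\ (u <= s - t \/ s <= u).
have cond u i : x <= u <= y -> g u = v -> i = 1 \/ i = -1 -> half_safe u i \/
    \forall u' \near u, A u' -> 0 < i * (u' - u) -> False.
  move=> xuy guv; have [h1 h2] := hs u xuy guv; case=> ->.
  - have [|yu] := ltP u y; first by left; exact: h1.
    by right; apply: (@nearW _ (nbhs u)) => u' [xu' _]; lra.
  - have [us|us] := EM (u = s).
      right; have : \forall u' \near u, s - t < u'.
        by apply: lt_nbhsr; rewrite us; lra.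
      by apply: filterS => u' u't [_ []]; rewrite us; lra.
    have [|ux] := ltP x u; first by left; exact: h2.
    by right; apply: (@nearW _ (nbhs u)) => u' [xu' _]; lra.
have xs1 : x <= s - t by lra.
have s12 : s - t <= s by lra.
apply: (@filterS2 _ 0^'+ _ _ _ _ _ (segment_avoid cond) (he t te')).
move=> h av [avp c1 c2].
rewrite /half_branch !mulN1r oppr0 addr0 in c1 c2.
have a1 u : x <= u <= s - t -> avoid_neg (g u - p h) (g u - p' h).
  by move=> xus; apply: av; [lra | split; [lra | left; lra]].
have a2 u : s <= u <= y -> avoid_neg (g u - p h) (g u - p' h).
  by move=> xus; apply: av; [lra | split; [lra | right; lra]].
have a3 u : s - t <= u <= s -> avoid_pos (g u - p h) (g u - p' h).
  move=> xus; have := avp (s - u); rewrite /half_branch.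
  have -> : s + -1 * (s - u) = u by ring.
  by apply; lra.
split.
  move=> u /andP[xu uy].
  have [us|/ltW us] := leP u (s - t); first by apply/avoid_neg_neq0/a1; rewrite xu.
  have [us2|/ltW us2] := leP u s; first by apply/avoid_pos_neq0/a3; rewrite us.
  by apply/avoid_neg_neq0/a2; rewrite us2.
move=> k k' w w'.
have [Kn|Kp|/eqP] := ltgtP (cross d d') 0; last by rewrite (negPf K0).
- rewrite nmulr_rgt0// in c1; rewrite nmulr_rlt0// in c2.
  rewrite (ltr0_sgz Kn); suff -> : k = k' + 1 by rewrite addrK.
  exact: (winds_cross xs1 s12 sy w w' a1 a2 a3).
- rewrite pmulr_rgt0// in c1; rewrite pmulr_rlt0// in c2.
  rewrite (gtr0_sgz Kp); apply: (winds_cross xs1 s12 sy w' w).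
  + by move=> u /a1/avoid_neg_sym.
  + by move=> u /a2/avoid_neg_sym.
  + by move=> u /a3/avoid_pos_sym.
  + by move: c2; rewrite /cross; lra.
  + by move: c1; rewrite /cross; lra.
Qed.

End Jump.

(** * Winding numbers at the four corners of a crossing *)
Section PlanarCrossing.
Variable R : realType.
Implicit Types (u x y s h : R).

(** Both half-branches are asked for their one-sided directions; this is what
    remains of differentiability when the two sides of a crossing are treated
    separately. *)
Definition velocity (g : R -> R * R) u (a : R * R) :=
  forall s, s = 1 \/ s = -1 -> ray (half_branch g u s) (g u) (s *: a).

Variables (g : R -> R * R) (cg : continuous g).
Hypothesis per : forall u, g (u + 1) = g u.

Variables (s t : R) (v a b : R * R).
Hypotheses (s0 : 0 <= s) (st : s < t) (t1 : t < 1).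
Hypotheses (gs : g s = v) (gt : g t = v).
Hypothesis times : forall u, 0 <= u < 1 -> g u = v -> u = s \/ u = t.
Hypotheses (vs : velocity g s a) (vt : velocity g t b) (K0 : cross a b != 0).
Variable P : bool -> bool -> R -> R * R.
Hypothesis rP : forall e f, ray (P e f) v ((-1) ^+ e *: a + (-1) ^+ f *: b).

Let half_s (i : R) : i = 1 \/ i = -1 -> ray (half_branch g s i) v (i *: a).
Proof. by rewrite -gs; exact: vs. Qed.
Let half_t (i : R) : i = 1 \/ i = -1 -> ray (half_branch g t i) v (i *: b).
Proof. by rewrite -gt; exact: vt. Qed.

Let rP00 : ray (P false false) v (a + b).
Proof. by have := @rP false false; rewrite !scale1r. Qed.
Let rP01 : ray (P false true) v (a - b).
Proof. by have := @rP false true; rewrite expr1 scale1r scaleN1r. Qed.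
Let rP10 : ray (P true false) v (- a + b).
Proof. by have := @rP true false; rewrite expr1 scale1r scaleN1r. Qed.
Let rP11 : ray (P true true) v (- a - b).
Proof. by have := @rP true true; rewrite expr1 !scaleN1r. Qed.

Let fwd : (1 : R) = 1 \/ (1 : R) = -1. Proof. by left. Qed.
Let bwd : (-1 : R) = 1 \/ (-1 : R) = -1. Proof. by right. Qed.

Let safe_t_a d (i : R) : i = 1 \/ i = -1 -> half_safe g v d b t i.
Proof.
move=> i1; exists (i *: b); first exact: half_t.
by case: i1 => ->; rewrite ?scale1r ?scaleN1r; [apply: Or32 | apply: Or33].
Qed.
Let safe_s_b d (i : R) : i = 1 \/ i = -1 -> half_safe g v d a s i.
Proof.
move=> i1; exists (i *: a); first exact: half_s.
by case: i1 => ->; rewrite ?scale1r ?scaleN1r; [apply: Or32 | apply: Or33].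
Qed.
Let safe_s_back : half_safe g v a b s (-1).
Proof. by exists (- a); [have := half_s bwd; rewrite scaleN1r | exact: Or31]. Qed.
Let safe_s_fwd : half_safe g v (- a) b s 1.
Proof.
by exists a; [have := half_s fwd; rewrite scale1r | apply: Or31; rewrite opprK].
Qed.
Let safe_t_back : half_safe g v b a t (-1).
Proof. by exists (- b); [have := half_t bwd; rewrite scaleN1r | exact: Or31]. Qed.
Let safe_t_fwd : half_safe g v (- b) a t 1.
Proof.
by exists b; [have := half_t fwd; rewrite scale1r | apply: Or31; rewrite opprK].
Qed.

Let KNa : cross (- a) b = - cross a b. Proof. by rewrite /cross /=; ring. Qed.
Let Kba : cross b a = - cross a b. Proof. by rewrite /cross /=; ring. Qed.
Let KNb : cross (- b) a = cross a b. Proof. by rewrite /cross /=; ring. Qed.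
Let KNa0 : cross (- a) b != 0. Proof. by rewrite KNa oppr_eq0. Qed.
Let Kba0 : cross b a != 0. Proof. by rewrite Kba oppr_eq0. Qed.
Let KNb0 : cross (- b) a != 0. Proof. by rewrite KNb. Qed.

Definition corner_winds x y h (k : bool -> bool -> int) :=
  forall e f, winds (fun u => g u - P e f h) x y (k e f).

Definition alternating_sum (k : bool -> bool -> int) : int :=
  k false false - k false true - k true false + k true true.

(** If the loop passes through [s], the jump across the half-branch that leaves
    [s] equals the jump across the half-branch that arrives there; otherwise
    both are zero.  The branch through [t] is not crossed by either of the two
    segments. *)
Lemma alternating_other x y : 0 <= x -> x < y -> y < 1 -> x <> s -> y <> s ->
  \forall h \near 0^'+, forall k, corner_winds x y h k -> alternating_sum k = 0.
Proof.
move=> x0 xy y1 xs ys.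
have tu u : x <= u <= y -> g u = v -> u = s \/ u = t.
  by move=> xuy; apply: times; lra.
have [sxy|sxy] := boolP (x <= s <= y).
- have j1 : x <= s < y by move/eqP: ys => ys; lra.
  have j2 : x < s <= y by move/eqP: xs => xs; lra.
  have h1 : forall u, x <= u <= y -> g u = v ->
     (u < y -> u <> s -> half_safe g v a b u 1) /\
     (x < u -> half_safe g v a b u (-1)).
    move=> u xuy guv; have [->|->] := tu u xuy guv; split=> // _.
      by move=> _; exact: safe_t_a fwd.
    exact: safe_t_a bwd.
  have h2 : forall u, x <= u <= y -> g u = v ->
     (u < y -> half_safe g v (- a) b u 1) /\
     (x < u -> u <> s -> half_safe g v (- a) b u (-1)).
    move=> u xuy guv; have [->|->] := tu u xuy guv; split=> // _.
      exact: safe_t_a fwd.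
    by move=> _; exact: safe_t_a bwd.
  have r1 : ray (half_branch g s 1) v a by have := half_s fwd; rewrite scale1r.
  have r2 : ray (half_branch g s (-1)) v (- a).
    by have := half_s bwd; rewrite scaleN1r.
  apply: (@filterS2 _ 0^'+ _ _ _ _ _ (jump_forward cg K0 rP00 rP01 j1 gs r1 h1)
    (jump_backward cg KNa0 rP10 rP11 j2 gs r2 h2)) => h [_ w1] [_ w2] k wk.
  have e1 := w1 _ _ (wk _ _) (wk _ _); have e2 := w2 _ _ (wk _ _) (wk _ _).
  rewrite KNa sgzN in e2; by rewrite /alternating_sum e1 e2; ring.
- have h1 d : forall u, x <= u <= y -> g u = v ->
     (u < y -> half_safe g v d b u 1) /\ (x < u -> half_safe g v d b u (-1)).
    move=> u xuy guv; have [e|->] := tu u xuy guv.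
      by case/negP: sxy; rewrite -e.
    by split=> _; [exact: safe_t_a fwd | exact: safe_t_a bwd].
  apply: (@filterS2 _ 0^'+ _ _ _ _ _
    (no_jump cg K0 rP00 rP01 (ltW xy) (h1 a))
    (no_jump cg KNa0 rP10 rP11 (ltW xy) (h1 (- a)))) => h w1 w2 k wk.
  have e1 := w1 _ _ (wk _ _) (wk _ _); have e2 := w2 _ _ (wk _ _) (wk _ _).
  by rewrite /alternating_sum e1 e2; ring.
Qed.

(** The loop from [s] to [t] contains the half-branch that leaves [s] but not
    the one that arrives there. *)
Lemma alternating_self : \forall h \near 0^'+, forall k,
  corner_winds s t h k -> alternating_sum k = sgz (cross a b).
Proof.
have [ps pst pt] : [/\ 0 <= s, s < t & t < 1] by split.
have tu u : s <= u <= t -> g u = v -> u = s \/ u = t.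
  by move=> xuy; apply: times; lra.
have j1 : s <= s < t by rewrite lexx.
have h1 : forall u, s <= u <= t -> g u = v ->
     (u < t -> u <> s -> half_safe g v a b u 1) /\
     (s < u -> half_safe g v a b u (-1)).
  move=> u xuy guv; have [->|->] := tu u xuy guv; split=> //.
    by rewrite ltxx.
  by move=> _; exact: safe_t_a bwd.
have h2 : forall u, s <= u <= t -> g u = v ->
     (u < t -> half_safe g v (- a) b u 1) /\
     (s < u -> half_safe g v (- a) b u (-1)).
  move=> u xuy guv; have [->|->] := tu u xuy guv; split=> //.
  - by rewrite ltxx.
  - by rewrite ltxx.
  - by move=> _; exact: safe_t_a bwd.
have r1 : ray (half_branch g s 1) v a by have := half_s fwd; rewrite scale1r.
apply: (@filterS2 _ 0^'+ _ _ _ _ _ (jump_forward cg K0 rP00 rP01 j1 gs r1 h1)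
  (no_jump cg KNa0 rP10 rP11 (ltW st) h2)) => h [_ w1] w2 k wk.
have e1 := w1 _ _ (wk _ _) (wk _ _); have e2 := w2 _ _ (wk _ _) (wk _ _).
by rewrite /alternating_sum e1 e2; ring.
Qed.

(** Three of the four adjacent pairs of corners are compared.  The pair
    separated by the half-branch that arrives at [s] is left aside, since this
    half-branch is at the wrong end of the period when [s = 0]. *)
Lemma checkerboard : \forall h \near 0^'+,
  (forall e f u, 0 <= u <= 1 -> g u - P e f h <> 0) /\
  forall k, corner_winds 0 1 h k ->
    [/\ k false true = k false false - sgz (cross a b),
        k true false = k false false + sgz (cross a b) &
        k true true = k false false].
Proof.
have [ps pst pt] : [/\ 0 <= s, s < t & t < 1] by split.
have tu u : 0 <= u <= 1 -> g u = v -> [\/ u = s, u = t | u = 1 /\ s = 0].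
  move=> u01 guv; have [u1|] := ltP u 1.
    by have [->|->] := times (u := u) (ltac:(lra)) guv; [apply: Or31|apply: Or32].
  move=> u1; have {u01 u1} u1 : u = 1 by lra.
  have g0 : g 0 = v by rewrite -guv u1 -[in RHS](add0r 1) per.
  have [//|e|e] := times (u := 0) _ g0; first by rewrite lexx ltr01.
    by apply: Or33.
  by exfalso; lra.
have safe_1 d d' i : s = 0 -> i = 1 \/ i = -1 -> half_safe g v d d' s i ->
    half_safe g v d d' 1 i.
  move=> s0' i1 [e re sf]; exists e => //; apply: cvg_trans re.
  apply: near_eq_cvg; apply: nearW => h /=; rewrite /half_branch s0' add0r.
  by rewrite [1 + _]addrC per.
have j1 : 0 <= s < 1 by lra.
have j2 : 0 <= t < 1 by lra.
have j3 : 0 < t <= 1 by lra.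
have r1 : ray (half_branch g s 1) v a by have := half_s fwd; rewrite scale1r.
have r2 : ray (half_branch g t 1) v b by have := half_t fwd; rewrite scale1r.
have r3 : ray (half_branch g t (-1)) v (- b).
  by have := half_t bwd; rewrite scaleN1r.
have h1 : forall u, 0 <= u <= 1 -> g u = v ->
     (u < 1 -> u <> s -> half_safe g v a b u 1) /\
     (0 < u -> half_safe g v a b u (-1)).
  move=> u u01 guv; have [->|->|[-> s0']] := tu u u01 guv; split=> //.
  - by move=> _ _; exact: safe_t_a fwd.
  - by move=> _; exact: safe_t_a bwd.
  - by rewrite ltxx.
  - by move=> _; apply: safe_1 => //.
have h2 : forall u, 0 <= u <= 1 -> g u = v ->
     (u < 1 -> u <> t -> half_safe g v b a u 1) /\
     (0 < u -> half_safe g v b a u (-1)).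
  move=> u u01 guv; have [->|->|[-> s0']] := tu u u01 guv; split=> //.
  - by move=> _ _; exact: safe_s_b fwd.
  - by move=> _; exact: safe_s_b bwd.
  - by rewrite ltxx.
  - by move=> _; apply: safe_1 => //; exact: safe_s_b bwd.
have h3 : forall u, 0 <= u <= 1 -> g u = v ->
     (u < 1 -> half_safe g v (- b) a u 1) /\
     (0 < u -> u <> t -> half_safe g v (- b) a u (-1)).
  move=> u u01 guv; have [->|->|[-> s0']] := tu u u01 guv; split=> //.
  - by move=> _; exact: safe_s_b fwd.
  - by move=> _ _; exact: safe_s_b bwd.
  - by rewrite ltxx.
  - by move=> _ _; apply: safe_1 => //; exact: safe_s_b bwd.
have rQ00 : ray (P false false) v (b + a) by rewrite addrC.
have rQ10 : ray (P true false) v (b - a) by rewrite addrC.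
have rQ01 : ray (P false true) v (- b + a) by rewrite addrC.
have rQ11 : ray (P true true) v (- b - a) by rewrite addrC.
apply: (@filterS3 _ 0^'+ _ _ _ _ _ _
  (jump_forward cg K0 rP00 rP01 j1 gs r1 h1)
  (jump_forward cg Kba0 rQ00 rQ10 j2 gt r2 h2)
  (jump_backward cg KNb0 rQ01 rQ11 j3 gt r3 h3)).
move=> h [f1 w1] [f2 w2] [f3 w3]; split.
  by move=> [] [] u u01; have [? ?] := f1 u u01; have [? ?] := f2 u u01;
    have [? ?] := f3 u u01.
move=> k wk.
have e1 := w1 _ _ (wk _ _) (wk _ _); have e2 := w2 _ _ (wk _ _) (wk _ _).
have e3 := w3 _ _ (wk _ _) (wk _ _).
rewrite Kba sgzN in e2; rewrite KNb in e3.
by split; [rewrite e1; ring | rewrite e2; ring | rewrite e3 e1].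
Qed.

End PlanarCrossing.

(** * Counting corners *)
Section Counting.

Lemma card_eq_finset (T : finType) (V : Type) (w : T -> V) (A : {set T}) k :
  injective w -> w @` [set` A] #= `I_k <-> #|A| = k.
Proof.
move=> wi.
have cA : w @` [set` A] #= `I_#|A|.
  have -> : w @` [set` A] = (w \o @enum_val _ (mem A)) @` [set: 'I_#|A|].
    apply/seteqP; split=> z [x].
      by move=> xA <-; exists (enum_rank_in xA x) => //=; rewrite enum_rankK_in.
    by move=> _ <-; exists (enum_val x) => //; exact: enum_valP.
  rewrite (card_eqr card_II); apply: inj_card_eq => i j _ _ /= /wi.
  exact: enum_val_inj.
split=> [ck|<-//].
by apply/card_eq_II; rewrite -(card_eql cA).
Qed.

(** Adjacent corners lie in different regions, so a region can only contain two
    opposite ones. *)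
Lemma corner_count_le2 (I : eqType) (J : bool -> bool -> I) j :
  J false false <> J false true -> J false false <> J true false ->
  J true true <> J false true -> J true true <> J true false ->
  (#|[set x : bool * bool | J x.1 x.2 == j]%SET| <= 2)%N.
Proof.
move=> n1 n2 n3 n4; rewrite -sum1dep_card big_mkcond /=.
rewrite -(pair_big xpredT xpredT (fun e f => if J e f == j then 1%N else 0%N)) /=.
rewrite !big_bool /=.
by do 4 case: eqP => //; congruence.
Qed.

Lemma sum_corner_count (n : nat) (J : bool -> bool -> 'I_n) (u : 'I_n -> int) :
  \sum_j (#|[set x : bool * bool | J x.1 x.2 == j]%SET|)%:Z * u j =
  u (J false false) + u (J false true) + u (J true false) + u (J true true).
Proof.
transitivity (\sum_j \sum_(x : bool * bool) ((J x.1 x.2 == j)%:Z * u j)).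
  apply: eq_bigr => j _; rewrite -sum1dep_card big_mkcond /= -mulr_suml.
  congr (_ * _); rewrite (big_morph Posz PoszD (erefl _)).
  by apply: eq_bigr => x _; case: eqP.
rewrite exchange_big /= -(pair_big xpredT xpredT
  (fun e f => \sum_j ((J e f == j)%:Z * u j))) /= !big_bool /=.
have E i : \sum_j ((i == j)%:Z * u j) = u i.
  rewrite (bigD1 i)//= eqxx mul1r big1 ?addr0// => j ji.
  by rewrite eq_sym (negPf ji) mul0r.
by rewrite !E; ring.
Qed.

Definition parity_sign (k : int) : int := if odd (absz k) then -1 else 1.

Lemma parity_signS (k s : int) : s = 1 \/ s = -1 ->
  parity_sign (k + s) = - parity_sign k.
Proof.
move=> hs; rewrite /parity_sign.
have -> : odd (absz (k + s)) = ~~ odd (absz k) by case: hs => ->; lia.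
by case: odd.
Qed.

Lemma parity_sign_sqr k : parity_sign k * parity_sign k = 1.
Proof. by rewrite /parity_sign; case: odd. Qed.

End Counting.

(** * Winding numbers as functions on the regions *)
Section IndexFunction.
Variable R : realType.

(** Compare with the constant curve [m]. *)
Lemma winds_half_plane (f : R -> R * R) m x y k : x <= y ->
  (forall u, x <= u <= y -> 0 < dot m (f u)) -> winds f x y k -> k = 0.
Proof.
move=> xy pos w.
have mm : 0 < dot m m.
  have := pos x; rewrite lexx xy => /(_ isT) mx.
  by apply: (@dot_sqr_gt0 _ (f x)); rewrite dotC gt_eqF.
have [t pt] : exists t, polar m t.
  have [m0|t t0] := @polar_cardinal _ m.
    by move: mm; rewrite m0 /dot /= mul0r addr0 ltxx.
  by eexists; exact: polar_atan t0.
have wm : winds (fun=> m) x y 0.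
  exists (fun=> t); split; last by rewrite subrr mul0r.
  by split=> [u|//]; exact: cvg_cst.
apply: (winds_eq xy w wm) => u xuy.
by apply: (@half_plane_avoid_neg _ m) => //; exact: pos.
Qed.

End IndexFunction.

Section Chart.
Variables (R : realType) (M : surface).
Local Notation V := 'rV[R]_(ambient_dim M).
Implicit Types (u x y h : R) (p w : V).

Definition corner_path (v w : V) : R -> V :=
  fun h => to_surface R M (v + h *: w).

Definition corner_vector (a b : V) (e f : bool) : V :=
  (-1) ^+ e *: a + (-1) ^+ f *: b.

(** A planar chart [Psi] of the surface, defined on an open set [D] that contains
    the curve.  The field [chart_pole] says that near a missing point of the
    surface the images are separated from the curve by a line, so that the
    curve does not wind around them.  The fields [chart_corner] and
    [chart_path] say that the paths into the corners stay on the surface and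
    have the expected directions in the chart. *)
Record chart (g : R -> V) (Psi : V -> R * R) (D : set V) : Prop := Chart {
  chart_open : open D;
  chart_continuous : forall p, D p -> {for p, continuous Psi};
  chart_inj : forall p p', points R M p -> points R M p' -> D p -> D p' ->
    Psi p = Psi p' -> p = p';
  chart_curve : forall u, D (g u);
  chart_pole : forall p, points R M p -> ~ D p -> \forall p' \near p,
    points R M p' -> D p' ->
    exists m, forall u, 0 < dot m (Psi (g u) - Psi p');
  chart_corner : forall s t v, double_at g s t v -> exists a b,
    [/\ velocity (Psi \o g) s a, velocity (Psi \o g) t b, cross a b != 0 &
      forall e f, ray
        (Psi \o corner_path v (corner_vector (derive1 g s) (derive1 g t) e f))
        (Psi v) ((-1) ^+ e *: a + (-1) ^+ f *: b)];
  chart_path : forall s t v e f, double_at g s t v -> exists2 eps : R,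
    0 < eps & forall h, 0 < h < eps ->
    let c := corner_path v (corner_vector (derive1 g s) (derive1 g t) e f) in
    [/\ points R M (c h), D (c h) & {for h, continuous c}]
}.

Variables (g : R -> V) (Psi : V -> R * R) (D : set V).
Hypotheses (Hg : generic_immersion g) (Hc : chart g Psi D).
Let A := points R M `\` range g.
Let gam := Psi \o g.

Lemma immersion_continuous : continuous g.
Proof.
move=> u; apply: differentiable_continuous; apply/derivable1_diffP.
exact: gi_derivable Hg u.
Qed.

Lemma chart_curve_continuous : continuous gam.
Proof.
move=> u; apply: continuous_comp; first exact: immersion_continuous.
by apply: (chart_continuous Hc); exact: chart_curve Hc u.
Qed.

Lemma off_curve p u : A p -> D p -> gam u - Psi p <> 0.
Proof.
move=> [Mp np] Dp e; apply: np; exists u => //.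
apply: (chart_inj Hc) => //; [exact: gi_surface Hg u|exact: chart_curve Hc u|].
by apply/eqP; rewrite -subr_eq0; apply/eqP.
Qed.

(** The winding number is locally constant off the curve: a point and its
    neighbours span segments that do not meet the curve, and near a missing
    point of the chart the winding number is zero, which is the value chosen at
    the missing point itself. *)
Lemma index_function x y : x <= y -> g x = g y -> exists W : V -> int,
  (forall p, A p -> D p -> winds (fun u => gam u - Psi p) x y (W p)) /\
  (forall p p', connected_component A p p' -> W p' = W p).
Proof.
move=> xy gxy.
pose W p : int := xget 0 [set k | A p /\ D p /\
  winds (fun u => gam u - Psi p) x y k].
have cf p : continuous (fun u => gam u - Psi p).
  by move=> u; apply: cvgB; [exact: chart_curve_continuous | exact: cvg_cst].
have W1 p : A p -> D p -> winds (fun u => gam u - Psi p) x y (W p).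
  move=> Ap Dp; rewrite /W; case: xgetP => [k _ [_ [_ //]]|no].
  have [||k wk] := winds_exists xy (cf p); first by move=> u _; exact: off_curve.
    by rewrite /gam /= gxy.
  by case: (no k); split=> //; split.
have W0 p : ~ D p -> W p = 0.
  by move=> nD; rewrite /W; case: xgetP => // k _ [_ []].
exists W; split=> // p p' App'.
have Ap : A p.
  have [//|nA] := EM (A p).
  by move: App'; rewrite connected_component_out.
apply: (@connected_locally_constant _ _ (connected_component A p)) => //.
- exact: component_connected.
- move=> z /connected_component_sub Az.
  have [Dz|nDz] := EM (D z).
  + have av : \forall z' \near z, forall u, x <= u <= y ->
        avoid_neg (gam u - Psi z) (gam u - Psi z').
      apply: (@segment_near R V (nbhs z) _ (fun z' u =>
        avoid_neg (gam u - Psi z) (gam u - Psi z'))) => u xuy.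
      apply: (@far_avoid R V (nbhs z) _ gam (fun=> Psi z) Psi (Psi z)).
      * exact: chart_curve_continuous.
      * move=> e; apply: (@off_curve z u Az Dz).
        by rewrite e subrr.
      * exact: cvg_cst.
      * exact: chart_continuous Hc z Dz.
    have Dn : \forall z' \near z, D z'.
      exact: open_nbhs_nbhs (conj (chart_open Hc) Dz).
    apply: filterS2 av Dn => z' av Dz' /connected_component_sub Az'.
    by rewrite (winds_eq xy (W1 z Az Dz) (W1 z' Az' Dz') av).
  + have [Mz _] := Az.
    apply: filterS (chart_pole Hc Mz nDz) => z' pole /connected_component_sub Az'.
    rewrite (W0 z)//; have [Dz'|/W0//] := EM (D z').
    have [Mz' _] := Az'; have [m mpos] := pole Mz' Dz'.
    by apply: (winds_half_plane xy _ (W1 z' Az' Dz')) => u _; exact: mpos.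
- exact: connected_component_refl.
Qed.

Lemma double_at_times s t v u : double_at g s t v -> 0 <= u < 1 -> g u = v ->
  u = s \/ u = t.
Proof.
move=> [s01 t01 st gs gt] u01 gu.
have gsu : g s = g u by rewrite gs gu.
have gut : g u = g t by rewrite gu gt.
have [->|->|e] := gi_double Hg s01 u01 t01 gsu gut; [by left|by right|].
by move: st; rewrite e ltxx.
Qed.

Lemma double_at_uniq s t s' t' v : double_at g s t v -> double_at g s' t' v ->
  s' = s /\ t' = t.
Proof.
move=> dd [s01 t01 st gs gt].
have [es|es] := double_at_times dd s01 gs; have [et|et] := double_at_times dd t01 gt.
- by move: st; rewrite es et ltxx.
- by [].
- by case: dd => _ _ st' _ _; move: st; rewrite es et; lra.
- by move: st; rewrite es et ltxx.
Qed.

Lemma reduce_time u : exists2 u', 0 <= u' < 1 & g u' = g u.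
Proof.
have nat_case n z : g (z + n%:R) = g z.
  elim: n => [|n IH]; first by rewrite addr0.
  by rewrite -natr1 addrA (gi_periodic Hg) IH.
exists (u - (Num.floor u)%:~R).
  by have := floor_itv u; rewrite intrD; lra.
case: (Num.floor u) => n; first by rewrite -[in RHS](subrK n%:R u) nat_case.
by rewrite NegzE mulrNz opprK nat_case.
Qed.

End Chart.

(** * The corners of a crossing and their regions *)

Lemma row_free_pair (R : fieldType) (n : nat) (a b : 'rV[R]_n) (x y : R) :
  row_free (col_mx a b) -> x *: a + y *: b = 0 -> x = 0 /\ y = 0.
Proof.
move=> fr e; have : row_mx x%:M y%:M *m col_mx a b == 0 :> 'rV_n.
  by rewrite mul_row_col !mul_scalar_mx e.
rewrite mulmx_free_eq0// => /eqP r0.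
have := congr1 lsubmx r0; have := congr1 rsubmx r0.
rewrite row_mxKl row_mxKr !linear0 => /matrixP /(_ 0 0) + /matrixP /(_ 0 0).
by rewrite !mxE eqxx !mulr1n => -> ->.
Qed.

Section Regions.
Variables (R : realType) (M : surface).
Local Notation V := 'rV[R]_(ambient_dim M).
Implicit Types (u x y h : R) (p w : V).
Variables (g : R -> V) (Psi : V -> R * R) (D : set V).
Hypotheses (Hg : generic_immersion g) (Hc : chart g Psi D).
Let A := points R M `\` range g.

(** The image of the time interval between [h] and [h'] is connected. *)
Lemma path_component (c : R -> V) eps :
  (forall h, 0 < h < eps -> A (c h) /\ {for h, continuous c}) ->
  forall h h', 0 < h < eps -> 0 < h' < eps ->
  connected_component A (c h) (c h').
Proof.
move=> hc h h' he he'.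
wlog le : h h' he he' / h <= h'.
  by move=> wl; have [/wl|/ltW/wl] := leP h h';
    [exact | move=> /(_ he' he); exact: connected_component_sym].
have sub z : `[h, h']%classic z -> 0 < z < eps by rewrite /= in_itv /=; lra.
apply: (@connected_component_max _ _ (c @` `[h, h']%classic)).
- by exists h => //=; rewrite in_itv /= lexx.
- by move=> _ [z hz <-]; have [] := hc z (sub z hz).
- apply: connected_continuous_connected; first exact: segment_connected.
  apply: continuous_in_subspaceT => z; rewrite inE => hz.
  by have [] := hc z (sub z hz).
- by exists h' => //=; rewrite in_itv /= lexx andbT.
Qed.

Lemma corner_vector_inj (s t : R) v : double_at g s t v ->
  injective (fun x : bool * bool =>
    corner_vector (derive1 g s) (derive1 g t) x.1 x.2).
Proof.
move=> dd [e f] [e' f'] /= /eqP; rewrite -subr_eq0 /corner_vector => /eqP h.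
have := @row_free_pair _ _ _ _ ((-1) ^+ e - (-1) ^+ e') ((-1) ^+ f - (-1) ^+ f')
  (gi_transverse Hg dd).
rewrite !scalerBl addrACA -opprD h => /(_ erefl) [].
move=> /eqP + /eqP; rewrite !subr_eq0 => /eqP /(@signr_inj R) -> /eqP.
by move=> /(@signr_inj R) ->.
Qed.

Lemma cornersE s t v w : double_at g s t v ->
  corners g v w <->
  exists x : bool * bool, corner_vector (derive1 g s) (derive1 g t) x.1 x.2 = w.
Proof.
move=> dd; split=> [[s' [t' [e [f [dd' ->]]]]]|[[e f] <-]].
  by have [-> ->] := double_at_uniq Hg dd dd'; exists (e, f).
by exists s, t, e, f.
Qed.

Lemma near_bool2 (P : bool -> bool -> R -> Prop) :
  (forall e f, \forall h \near 0^'+, P e f h) ->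
  \forall h \near 0^'+, forall e f, P e f h.
Proof.
move=> hP; near=> h => -[] []; near: h; exact: hP.
Unshelve. all: by end_near. Qed.

Definition is_index x y (W : V -> int) :=
  (forall p, A p -> D p -> winds (fun u => (Psi \o g) u - Psi p) x y (W p)) /\
  (forall p p', connected_component A p p' -> W p' = W p).

Lemma near_witness (P : R -> Prop) : (\forall h \near 0^'+, P h) ->
  exists h, P h.
Proof. by move=> hP; exact: (@filter_ex _ 0^'+ _ _ hP). Qed.

(** The values of the winding numbers at the corners of a crossing do not depend
    on the distance to the crossing, because each corner path eventually stays
    in one region; [q] chooses a point in each of these regions.  The estimates
    of the planar case, valid at small distances only, thus hold at [q]. *)
Lemma crossing_values s t v : double_at g s t v ->
  exists (q : bool -> bool -> V) (S : int), [/\ S = 1 \/ S = -1,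
    forall e f, A (q e f),
    forall e f U, regions g U ->
      corner_in v (corner_vector (derive1 g s) (derive1 g t) e f) U <->
      U (q e f),
    forall W, is_index 0 1 W ->
      [/\ W (q false true) = W (q false false) - S,
          W (q true false) = W (q false false) + S &
          W (q true true) = W (q false false)] &
    forall s' t' v' W, double_at g s' t' v' -> is_index s' t' W ->
      alternating_sum (fun e f => W (q e f)) = if v' == v then S else 0].
Proof.
move=> dd; have [s01 t01 st gs gt] := dd.
have [s0 s1] := andP s01; have [t0 t1] := andP t01.
have [a [b [va vb K0 rP]]] := chart_corner Hc dd.
set cp := fun e f =>
  corner_path v (corner_vector (derive1 g s) (derive1 g t) e f).
have cg := chart_curve_continuous Hg Hc.
have per u : (Psi \o g) (u + 1) = (Psi \o g) u.
  by rewrite /= (gi_periodic Hg).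
have gam_eq u u' : (Psi \o g) u = (Psi \o g) u' -> g u = g u'.
  by move=> e; apply: (chart_inj Hc) => //;
    [exact: gi_surface Hg u | exact: gi_surface Hg u' |
     exact: chart_curve Hc u | exact: chart_curve Hc u'].
have gams : (Psi \o g) s = Psi v by rewrite /= gs.
have gamt : (Psi \o g) t = Psi v by rewrite /= gt.
have times u : 0 <= u < 1 -> (Psi \o g) u = Psi v -> u = s \/ u = t.
  move=> u01 e; apply: (double_at_times Hg dd u01).
  by rewrite -gs; apply: gam_eq; rewrite e gams.
have chk := checkerboard cg per s0 st t1 gams gamt times va vb K0 rP.
have [eps eps0 heps] : exists2 eps : R, 0 < eps & forall h, 0 < h < eps ->
    forall e f, [/\ A (cp e f h), D (cp e f h) & {for h, continuous (cp e f)}].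
  have near_path : \forall h \near 0^'+, forall e f,
      [/\ A (cp e f h), D (cp e f h) & {for h, continuous (cp e f)}].
    have paths : \forall h \near 0^'+, forall e f,
      [/\ points R M (cp e f h), D (cp e f h) & {for h, continuous (cp e f)}].
      apply: near_bool2 => e f; have [d d0 hd] := chart_path Hc e f dd.
      near=> h; apply: hd; apply/andP; split; near: h.
        exact: nbhs_right_gt.
      exact: nbhs_right_lt.
    have offs : \forall h \near 0^'+, forall e f u, 0 <= u <= 1 ->
        (Psi \o g) u - (Psi \o cp e f) h <> 0 by apply: filterS chk => h [].
    apply: filterS2 paths offs => h path off e f.
    have [Mc Dc cc] := path e f.
    split=> //; split=> // -[u _ gu].
    have [u' u'01 gu'] := reduce_time Hg u.
    apply: (off e f u'); first lra.
    by rewrite /= gu' gu subrr.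
  move: near_path => /nbhs_ballP[d /= d0 hd]; exists d => // h /andP[h0 hd'].
  by apply: hd => //; rewrite /ball /= sub0r normrN gtr0_norm.
(* All paths stay off the curve up to [eps], so the points at [eps / 2] represent
   the regions of the corners. *)
have h0P : 0 < eps / 2 < eps by lra.
have comp e f h : 0 < h < eps ->
    connected_component A (cp e f (eps / 2)) (cp e f h).
  move=> he; apply: (@path_component (cp e f) eps) => // h' /heps /(_ e f).
  by case.
have Wq W e f h x y : is_index x y W -> 0 < h < eps ->
    W (cp e f h) = W (cp e f (eps / 2)).
  by move=> [_ Wc] he; apply: Wc; exact: comp.
have small : \forall h \near 0^'+, 0 < h < eps.
  near=> h; apply/andP; split; near: h; [exact: nbhs_right_gt|exact: nbhs_right_lt].
have winds_at W x y h : is_index x y W -> 0 < h < eps ->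
    corner_winds (Psi \o g) (fun e f => Psi \o cp e f) x y h
      (fun e f => W (cp e f (eps / 2))).
  move=> iW he e f; rewrite -(Wq W e f h x y iW he).
  by have [Ah Dh _] := heps h he e f; exact: iW.1.
exists (fun e f => cp e f (eps / 2)), (sgz (cross a b)); split.
- have [Kn|Kp|/eqP] := ltgtP (cross a b) 0; last by rewrite (negPf K0).
    by right; rewrite ltr0_sgz.
  by left; rewrite gtr0_sgz.
- by move=> e f; have [] := heps _ h0P e f.
- move=> e f _ [z Az <-]; split=> [hU|zq].
    have hU' : \forall h \near 0^'+, connected_component A z (cp e f h) := hU.
    have [h [hz he]] := near_witness (filterI hU' small).
    apply: connected_component_trans hz _.
    by apply: connected_component_sym; exact: comp.
  rewrite /corner_in; apply: (@filterS _ 0^'+ _ _ _ _ small) => h he.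
  by apply: connected_component_trans zq _; exact: comp.
- move=> W iW.
  have [h [[_ ck] he]] := near_witness (filterI chk small).
  exact: (ck _ (winds_at W 0 1 h iW he)).
- move=> s' t' v' W dd' iW; have [s01' t01' st' gs' gt'] := dd'.
  have [s0' s1'] := andP s01'; have [t0' t1'] := andP t01'.
  have [vv|vv] := eqVneq v' v.
    rewrite vv in dd'; have [ss tt] := double_at_uniq Hg dd dd'.
    rewrite ss tt in iW.
    have self := alternating_self cg s0 st t1 gams gamt times va vb K0 rP.
    have [h [al he]] := near_witness (filterI self small).
    exact: (al _ (winds_at W s t h iW he)).
  have ne1 : s' <> s by move=> e; move/eqP: vv; rewrite -gs' -gs e.
  have ne2 : t' <> s by move=> e; move/eqP: vv; rewrite -gt' -gs e.
  have other := alternating_other cg gams gamt times va vb K0 rP s0' st' t1' ne1 ne2.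
  have [h [al he]] := near_witness (filterI other small).
  exact: (al _ (winds_at W s' t' h iW he)).
Unshelve. all: by end_near. Qed.

End Regions.

(** * Solving the linear system *)
Section Solution.
Variables (R : realType) (M : surface).
Local Notation V := 'rV[R]_(ambient_dim M).
Variables (g : R -> V) (Psi : V -> R * R) (D : set V).
Hypotheses (Hg : generic_immersion g) (Hc : chart g Psi D).
Let A := points R M `\` range g.

Lemma sum_four_eq (m : nat) (F : 'I_m -> bool -> bool -> int) (c : 'I_m -> int) i :
  (forall k, F k false false + F k false true + F k true false + F k true true =
    if k == i then c k else 0) ->
  \sum_k F k false false + \sum_k F k false true + \sum_k F k true false +
    \sum_k F k true true = c i.
Proof.
move=> hF; rewrite -!big_split /= (eq_bigr _ (fun k _ => hF k)).
by rewrite -big_mkcond big_pred1_eq.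
Qed.

(** The weight attached to the crossing [c] is normalized by its corner sum at
    [c], which is a unit, and multiplied by [- b c]. *)
Theorem chart_solution (n : nat) (v : 'I_n -> V)
    (Hv : set_bij [set: 'I_n] (crossings g) v)
    (r : 'I_(n + 2) -> set V)
    (Hr : set_bij [set: 'I_(n + 2)] (regions g) r) (b : 'cV[int]_n) :
  exists u : 'cV[int]_(n + 2), region_choice_matrix g v r *m u + b = 0.
Proof.
have [vC vI _] := Hv; have [rC rI rS] := Hr.
have /choice[st dd] : forall i, exists st : R * R, double_at g st.1 st.2 (v i).
  by move=> i; have [s [t dst]] := vC i I; exists (s, t).
have /choice[pt ptP] : forall j, exists p, A p /\ r j = connected_component A p.
  by move=> j; have [p Ap <-] := rC j I; exists p.
have rE j p : r j p -> A p /\ r j = connected_component A p.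
  have [_ ->] := ptP j => h; split; first exact: connected_component_sub h.
  exact: same_connected_component.
have r_disj j j' p : r j p -> r j' p -> j = j'.
  by move=> /rE[_ e] /rE[_ e']; apply: rI; rewrite ?inE// e e'.
have Wpt W x y j p : is_index g Psi D x y W -> r j p -> W p = W (pt j).
  by move=> [_ Wc]; have [_ ->] := ptP j; exact: Wc.
have g01 : g 0 = g 1 by rewrite -(gi_periodic Hg 0) add0r.
have [WD iWD] := index_function Hg Hc ler01 g01.
have /choice[WC iWC] : forall c, exists W, is_index g Psi D (st c).1 (st c).2 W.
  move=> c; have [_ _ lt gs gt] := dd c.
  by apply: (index_function Hg Hc (ltW lt)); rewrite gs gt.
have /choice[q /choice[S qSP]] := fun i => crossing_values Hg Hc (dd i).
pose w i (x : bool * bool) := corner_vector (derive1 g (st i).1)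
  (derive1 g (st i).2) x.1 x.2.
have /choice[J JP] : forall i, exists J : bool -> bool -> 'I_(n + 2),
    forall e f, r (J e f) (q i e f).
  move=> i; have [_ Aq _ _ _] := qSP i.
  have /choice[J JP] : forall x : bool * bool, exists j, r j (q i x.1 x.2).
    move=> [e f] /=; have [|j _ jE] := rS (connected_component A (q i e f)).
      by exists (q i e f).
    by exists j; rewrite jE; exact: connected_component_refl (Aq e f).
  by exists (fun e f => J (e, f)) => e f; exact: (JP (e, f)).
have corner_inE i x j : corner_in (v i) (w i x) (r j) <-> J i x.1 x.2 = j.
  have [_ _ cE _ _] := qSP i; rewrite (cE x.1 x.2 (r j) (rC j I)).
  by split=> [h|<-]; [exact: r_disj (JP i _ _) h | exact: JP].
pose eps j := parity_sign (WD (pt j)).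
have epsP i : [/\ eps (J i false true) = - eps (J i false false),
    eps (J i true false) = - eps (J i false false) &
    eps (J i true true) = eps (J i false false)].
  have [S1 _ _ /(_ WD iWD) wD _] := qSP i.
  have S1' : - S i = 1 \/ - S i = -1 by case: S1 => ->; [right|left].
  move: wD; rewrite !(Wpt WD 0 1 _ _ iWD (JP i _ _)) /eps => -[-> -> ->].
  by rewrite !parity_signS.
have epsN j : eps j <> - eps j.
  by rewrite /eps /parity_sign; case: odd.
have entryE i j : region_choice_matrix g v r i j =
    (#|[set x : bool * bool | J i x.1 x.2 == j]%SET|)%:Z.
  have le2 : (#|[set x : bool * bool | J i x.1 x.2 == j]%SET| <= 2)%N.
    have [e1 e2 e3] := epsP i.
    apply: corner_count_le2 => /(congr1 eps).
    - by rewrite e1; exact: epsN.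
    - by rewrite e2; exact: epsN.
    - by rewrite e1 e3; exact: epsN.
    - by rewrite e2 e3; exact: epsN.
  have touchE k : touches g k (r j) (v i) <->
      #|[set x : bool * bool | J i x.1 x.2 == j]%SET| = k.
    rewrite -(card_eq_finset _ _ (corner_vector_inj Hg (dd i))) /touches.
    suff -> : [set c | corners g (v i) c /\ corner_in (v i) c (r j)] =
        w i @` [set` [set x : bool * bool | J i x.1 x.2 == j]%SET] by [].
    apply/seteqP; split=> [c [/(cornersE Hg _ (dd i))[x <-] /corner_inE xj]|].
      by exists x => //=; rewrite inE xj.
    move=> _ [x xJ <-]; move: xJ; rewrite /= inE => /eqP xj.
    by split; [apply/(cornersE Hg _ (dd i)); exists x | exact/corner_inE].
  rewrite mxE; move: le2 touchE; set N := #|_| => le2 touchE.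
  case: asboolP => [/touchE -> //|n2]; case: asboolP => [/touchE -> //|n1].
  suff -> : N = 0%N by [].
  have : N <> 2 by move=> e; apply: n2; apply/touchE.
  have : N <> 1 by move=> e; apply: n1; apply/touchE.
  by move: le2; case: (N) => [|[|[]]].
exists (\col_j - \sum_c b c 0 * (eps (J c false false) * S c) *
  (eps j * WC c (pt j))).
apply/matrixP => i z; rewrite !mxE (ord1 z).
rewrite (eq_bigr _ (fun j _ => congr2 *%R (entryE i j) (mxE _ _ j 0))).
rewrite (sum_corner_count (J i)).
pose G c e f : int := b c 0 * (eps (J c false false) * S c) *
  (eps (J i e f) * WC c (pt (J i e f))).
rewrite -!opprD (@sum_four_eq _ G (fun=> b i 0) i) ?addNr// => c.
have [e1 e2 e3] := epsP i.
have [S1 _ _ _ /(_ _ _ _ _ (dd c) (iWC c))] := qSP i.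
rewrite /alternating_sum !(Wpt (WC c) _ _ _ _ (iWC c) (JP i _ _)) /G e1 e2 e3.
set k00 := WC c _; set k01 := WC c _; set k10 := WC c _; set k11 := WC c _.
have -> : (v c == v i) = (c == i).
  by apply/eqP/eqP => [/vI|-> //]; apply; rewrite inE.
have SS : S i * S i = 1 by case: S1 => ->.
have EE := parity_sign_sqr (WD (pt (J i false false))).
rewrite -/(eps _) in EE.
set E := eps (J i false false) in EE *.
move=> alt; transitivity (b c 0 * (eps (J c false false) * S c) * E *
    (k00 - k01 - k10 + k11)); first by ring.
rewrite alt; case: eqP => [->|_]; last by rewrite mulr0.
rewrite -/E; transitivity (b i 0 * (E * E) * (S i * S i)); first by ring.
by rewrite EE SS !mulr1.
Qed.

End Solution.

(** * Velocities from derivatives *)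
Section Derivatives.
Variable R : realType.

Lemma is_derive_right (f : R -> R) (d : R) : is_derive (0 : R) 1 f d ->
  (fun t => t^-1 * (f t - f 0)) @ 0^'+ --> d.
Proof.
move=> df.
have cd : (fun h => h^-1 *: ((f \o shift 0) (h *: 1) - f 0)) @ 0^' --> d.
  rewrite -(@derive_val _ _ _ _ _ _ _ df); exact: (@ex_derive _ _ _ _ _ _ _ df).
apply: cvg_trans (cvg_dnbhs_at_right cd); apply: near_eq_cvg.
by apply: nearW => t /=; rewrite addr0 /GRing.scale /= mulr1.
Qed.

Lemma ray_derive (c : R -> R * R) (d : R * R) :
  is_derive (0 : R) 1 (fun t => (c t).1) d.1 ->
  is_derive (0 : R) 1 (fun t => (c t).2) d.2 -> ray c (c 0) d.
Proof.
move=> d1 d2; case: d d1 d2 => x y /= d1 d2.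
rewrite /ray.
have -> : (fun t => t^-1 *: (c t - c 0)) =
  (fun t => (t^-1 * ((c t).1 - (c 0).1), t^-1 * ((c t).2 - (c 0).2))).
  by apply/funext => t.
by apply: (@cvg_pair _ _ _ _ (nbhs x) (nbhs y)); exact: is_derive_right.
Qed.

Lemma velocity_derive (f : R -> R * R) (u : R) (d : R * R) :
  is_derive u 1 (fun t => (f t).1) d.1 ->
  is_derive u 1 (fun t => (f t).2) d.2 -> velocity f u d.
Proof.
move=> d1 d2 s s1.
have aff (F : R -> R) e : is_derive u 1 F e ->
    is_derive (0 : R) 1 (fun t => F (u + s * t)) (s * e).
  move=> dF; have := @is_derive1_comp _ F (fun t => u + s * t) 0 e s.
  rewrite mulr0 addr0 mulrC; apply=> //.
  by apply: is_derive_eq; rewrite /GRing.scale /=; ring.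
have h : half_branch f u s 0 = f u by rewrite /half_branch mulr0 addr0.
by rewrite -h; apply: ray_derive; exact: aff.
Qed.

Lemma is_derive_coord (m : nat) (g : R -> 'rV[R]_m) u i : derivable g u 1 ->
  is_derive u 1 (fun t => g t 0 i) (derive1 g u 0 i).
Proof.
move=> dg; apply: DeriveDef; first exact: (derivable_mxP _ _ _).1 dg 0 i.
by rewrite derive1E derive_mx// mxE.
Qed.

Lemma cross_dependent (z w : R * R) : cross z w = 0 -> exists x y : R,
  (x <> 0 \/ y <> 0) /\ x *: z + y *: w = 0.
Proof.
case: z w => [z1 z2] [w1 w2]; rewrite /cross /= => c0.
have P (p q : R) : p = 0 -> q = 0 -> (p, q) = 0 :> R * R by move=> -> ->.
have [w10|w10] := eqVneq w1 0; last first.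
  by exists w1, (- z1); split; [left; exact/eqP|];
    apply: P; rewrite /= /GRing.scale /=; lra.
have [w20|w20] := eqVneq w2 0; last first.
  by exists w2, (- z2); split; [left; exact/eqP|];
    apply: P; rewrite /= /GRing.scale /=; lra.
by exists 0, 1; split; [right; exact/eqP/oner_neq0|];
  apply: P; rewrite /= /GRing.scale /=; lra.
Qed.

Lemma continuous_pair (T : topologicalType) (f1 f2 : T -> R) (x : T) :
  {for x, continuous f1} -> {for x, continuous f2} ->
  {for x, continuous (fun y => (f1 y, f2 y))}.
Proof. by move=> c1 c2; exact: (cvg_pair c1 c2). Qed.

End Derivatives.

(** * The chart of the plane *)
Section PlaneChart.
Variable R : realType.

Definition plane_pair (p : 'rV[R]_2) : R * R := (p 0 0, p 0 1).

Lemma plane_pair_inj : injective plane_pair.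
Proof.
move=> p p' [e0 e1]; apply/rowP => i.
by case: i => [[|[|//]]] hi; [move: e0|move: e1];
  congr (p _ _ = p' _ _); apply/val_inj.
Qed.

Lemma plane_pair_continuous : continuous plane_pair.
Proof. by move=> p; apply: continuous_pair; exact: coord_continuous. Qed.

Lemma plane_pair_linear (x y : R) (a b : 'rV[R]_2) :
  plane_pair (x *: a + y *: b) = x *: plane_pair a + y *: plane_pair b.
Proof. by rewrite /plane_pair !mxE. Qed.

Lemma plane_pair_ray (v w : 'rV[R]_2) :
  ray (fun h => plane_pair (v + h *: w)) (plane_pair v) (plane_pair w).
Proof.
have c0 : plane_pair v = (fun h => plane_pair (v + h *: w)) 0.
  by rewrite scale0r addr0.
have coordE i : is_derive (0 : R) 1 (fun h => (v + h *: w) 0 i) (w 0 i).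
  have -> : (fun h => (v + h *: w) 0 i) = (fun h => v 0 i + h * w 0 i).
    by apply/funext => h; rewrite !mxE.
  by apply: is_derive_eq; rewrite /GRing.scale /=; ring.
by rewrite c0; apply: ray_derive; exact: coordE.
Qed.

Lemma line_continuous (v w : 'rV[R]_2) : continuous (fun h : R => v + h *: w).
Proof.
move=> h; apply: cvgD; first exact: cvg_cst.
by apply: cvgZr_tmp; exact: cvg_id.
Qed.

Lemma plane_chart (g : R -> 'rV[R]_2) :
  @generic_immersion R Plane g -> @chart R Plane g plane_pair setT.
Proof.
move=> Hg; split.
- exact: openT.
- by move=> p _; exact: plane_pair_continuous.
- by move=> p p' _ _ _ _; exact: plane_pair_inj.
- by [].
- by move=> p _ /(_ I).
- move=> s t v dd.
  exists (plane_pair (derive1 g s)), (plane_pair (derive1 g t)).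
  have vel u : velocity (plane_pair \o g) u (plane_pair (derive1 g u)).
    by apply: velocity_derive; apply: is_derive_coord; exact: gi_derivable Hg u.
  split; [exact: vel | exact: vel | |].
  + apply/eqP => /cross_dependent[x [y [xy]]]; rewrite -plane_pair_linear => e.
    have pair0 : plane_pair 0 = 0 by rewrite /plane_pair !mxE.
    have xy0 := plane_pair_inj (etrans e (esym pair0)).
    have [] := @row_free_pair _ _ _ _ x y (gi_transverse Hg dd).
      exact: xy0.
    by case: xy.
  + by move=> e f; rewrite -plane_pair_linear; exact: plane_pair_ray.
- move=> s t v e f dd; exists 1; first exact: ltr01.
  by move=> h _ /=; split=> //; exact: line_continuous.
Qed.

End PlaneChart.

(** * Orthonormal frames *)
Section DotProduct.
Variables (R : realType) (m : nat).
Local Notation V := 'rV[R]_m.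
Implicit Types (x y z : V).

Definition dp x y : R := \sum_i x 0 i * y 0 i.

Lemma dpC x y : dp x y = dp y x.
Proof. by apply: eq_bigr => i _; rewrite mulrC. Qed.

Lemma dpDr x y z : dp x (y + z) = dp x y + dp x z.
Proof. by rewrite -big_split; apply: eq_bigr => i _; rewrite mxE mulrDr. Qed.

Lemma dpZr x (a : R) y : dp x (a *: y) = a * dp x y.
Proof. by rewrite mulr_sumr; apply: eq_bigr => i _; rewrite mxE mulrCA. Qed.

Lemma dpNr x y : dp x (- y) = - dp x y.
Proof. by rewrite -scaleN1r dpZr mulN1r. Qed.

Lemma dpBr x y z : dp x (y - z) = dp x y - dp x z.
Proof. by rewrite dpDr dpNr. Qed.

Lemma dp_orthogonal_span x y z (a b : R) : dp x y = 0 -> dp x z = 0 ->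
  dp x (a *: y + b *: z) = 0.
Proof. by move=> xy xz; rewrite dpDr !dpZr xy xz !mulr0 addr0. Qed.

Lemma dp_ge0 x : 0 <= dp x x.
Proof. by apply: sumr_ge0 => i _; rewrite -expr2 sqr_ge0. Qed.

Lemma dp_eq0 x : dp x x = 0 -> x = 0.
Proof.
move=> x0; apply/rowP => i; rewrite mxE; apply/eqP; rewrite -sqrf_eq0 expr2.
have /psumr_eq0P/(_ i)/(_ erefl) -> // : \sum_(i < m) x 0 i * x 0 i = 0 by [].
by move=> j _; rewrite -expr2 sqr_ge0.
Qed.

Lemma is_derive_dp e (g : R -> V) u : derivable g u 1 ->
  is_derive u 1 (fun t => dp e (g t)) (dp e (derive1 g u)).
Proof.
move=> dg; have -> : (fun t => dp e (g t)) = \sum_i (fun t => e 0 i * g t 0 i).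
  by apply/funext => t; rewrite fct_sumE.
apply: is_derive_sum => i; have dgi := is_derive_coord i dg.
by apply: is_derive_eq; rewrite /GRing.scale /=; ring.
Qed.

Lemma is_derive_dp_sqr (g : R -> V) u : derivable g u 1 ->
  is_derive u 1 (fun t => dp (g t) (g t)) (2 * dp (g u) (derive1 g u)).
Proof.
move=> dg.
have -> : (fun t => dp (g t) (g t)) = \sum_i (fun t => g t 0 i * g t 0 i).
  by apply/funext => t; rewrite fct_sumE.
rewrite mulr_sumr.
apply: is_derive_sum => i; have dgi := is_derive_coord i dg.
by apply: is_derive_eq; rewrite /GRing.scale /=; ring.
Qed.

Lemma continuous_dp e : continuous (dp e).
Proof.
apply: (@continuous_big R _ +%R 0 xpredT _ V); first exact: add_continuous.
move=> i _ x.
apply: (@cvgM _ _ (nbhs x)); first exact: cvg_cst.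
exact: (@coord_continuous R 1 m 0 i x).
Qed.

Lemma euclidean_normE x : euclidean_norm x = Num.sqrt (dp x x).
Proof. by congr Num.sqrt; apply: eq_bigr => i _; rewrite expr2. Qed.

Lemma euclidean_norm_eq1 x : euclidean_norm x = 1 <-> dp x x = 1.
Proof.
rewrite euclidean_normE; split=> [e|->]; last exact: sqrtr1.
by rewrite -(sqr_sqrtr (dp_ge0 x)) e expr1n.
Qed.

End DotProduct.

(** For [q = (a, b, c)] with [c <> - 1], the frame is completed by the
    images of the first two basis vectors under the rotation of least angle
    that takes the third one to [q]. *)
Lemma orthonormal_frame (R : realType) (q : 'rV[R]_3) : dp q q = 1 ->
  exists e1 e2 : 'rV[R]_3, forall x y,
    dp x y = dp e1 x * dp e1 y + dp e2 x * dp e2 y + dp q x * dp q y.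
Proof.
have dpE (x y : 'rV[R]_3) : dp x y = x 0 0 * y 0 0 + x 0 1 * y 0 1 + x 0 2 * y 0 2.
  rewrite /dp !big_ord_recl big_ord0 addr0 addrA.
  by congr (_ * _ + _ * _ + _ * _); congr (_ _ _); apply/val_inj.
pose vec (a b c : R) : 'rV[R]_3 := \row_j [:: a; b; c]`_j.
have vecE a b c x : dp (vec a b c) x = a * x 0 0 + b * x 0 1 + c * x 0 2.
  by rewrite dpE !mxE.
rewrite dpE; set a := q 0 0; set b := q 0 1; set c := q 0 2 => q1.
have [c1|c1] := eqVneq (1 + c) 0.
  exists (vec 1 0 0), (vec 0 1 0) => x y; rewrite !vecE !dpE -/a -/b -/c.
  have cE : c = -1 by lra.
  have : a ^+ 2 + b ^+ 2 = 0 by move: q1; rewrite cE !expr2; lra.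
  move/eqP; rewrite paddr_eq0 ?sqr_ge0// !sqrf_eq0 => /andP[/eqP -> /eqP ->].
  by rewrite cE; ring.
pose k := (1 + c)^-1; have kc : k * (1 + c) = 1 by rewrite mulVf.
have kE : k * (a * a + b * b) = 1 - c.
  have -> : a * a + b * b = (1 + c) * (1 - c) by lra.
  by rewrite mulrA kc mul1r.
have kkE : k * k * (a * a + b * b) = 2 * k - 1.
  rewrite -mulrA kE; have : k * c = 1 - k by lra.
  by lra.
exists (vec (1 - a * a * k) (- (a * b * k)) (- a)),
  (vec (- (a * b * k)) (1 - b * b * k) (- b)) => x y.
rewrite !vecE !dpE -/a -/b -/c; apply/eqP; rewrite -subr_eq0; apply/eqP.
(* The difference of the two sides is a combination of [kkE], [kE], [q1]. *)
transitivity (- ((x 0 0 * y 0 0 * a * a + (x 0 0 * y 0 1 + x 0 1 * y 0 0) * a * b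
   + x 0 1 * y 0 1 * b * b) * (k * k * (a * a + b * b) - (2 * k - 1))
   + ((x 0 0 * y 0 2 + x 0 2 * y 0 0) * a + (x 0 1 * y 0 2 + x 0 2 * y 0 1) * b)
     * (k * (a * a + b * b) - (1 - c))
   + x 0 2 * y 0 2 * (a * a + b * b + c * c - 1))); first by ring.
by rewrite kkE kE q1 !subrr; ring.
Qed.

(** * Stereographic projection *)
Section SphereChart.
Variable R : realType.
Local Notation V := 'rV[R]_3.
Implicit Types (x y z w : V).
Variables (e1 e2 q : V).
Hypothesis parseval : forall x y,
  dp x y = dp e1 x * dp e1 y + dp e2 x * dp e2 y + dp q x * dp q y.
Hypothesis q1 : dp q q = 1.

(** Projection from [q] onto the plane through the origin orthogonal to [q], in
    the coordinates of the frame. *)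
Definition stereo (x : V) : R * R :=
  (dp e1 x / (1 - dp q x), dp e2 x / (1 - dp q x)).

(** The differential of [stereo] at [x] in the direction [w]. *)
Definition dstereo (x w : V) : R * R :=
  (dp e1 w / (1 - dp q x) + dp e1 x * dp q w / (1 - dp q x) ^+ 2,
   dp e2 w / (1 - dp q x) + dp e2 x * dp q w / (1 - dp q x) ^+ 2).

Let D : set V := [set x | dp q x != 1].

Lemma frame_eq0 x : dp e1 x = 0 -> dp e2 x = 0 -> dp q x = 0 -> x = 0.
Proof. by move=> h1 h2 h3; apply: dp_eq0; rewrite parseval h1 h2 h3; ring. Qed.

Lemma frame_eq x y : dp e1 x = dp e1 y -> dp e2 x = dp e2 y ->
  dp q x = dp q y -> x = y.
Proof.
move=> h1 h2 h3; apply/eqP; rewrite -subr_eq0; apply/eqP.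
by apply: frame_eq0; rewrite dpBr ?h1 ?h2 ?h3 subrr.
Qed.

(** Parseval's identity for [q] itself leaves no room for other
    components. *)
Lemma pole_coord : dp e1 q = 0 /\ dp e2 q = 0.
Proof.
have := parseval q q; rewrite q1 mulr1 => /eqP.
rewrite -subr_eq0 opprD addrCA subrr addr0 oppr_eq0 -!expr2.
by rewrite paddr_eq0 ?sqr_ge0// !sqrf_eq0 => /andP[/eqP -> /eqP ->].
Qed.

Lemma sphere_pole x : dp x x = 1 -> dp q x = 1 -> x = q.
Proof.
move=> x1 qx; have [p1 p2] := pole_coord; have := parseval x x.
rewrite x1 qx mulr1 => /eqP.
rewrite -subr_eq0 opprD addrCA subrr addr0 oppr_eq0 -!expr2.
rewrite paddr_eq0 ?sqr_ge0// !sqrf_eq0 => /andP[/eqP h1 /eqP h2].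
by apply: frame_eq; rewrite ?h1 ?h2 ?qx ?p1 ?p2 ?q1.
Qed.

(** The square of the norm of the image is [(1 + c) / (1 - c)], which determines
    the height [c] of the point, hence the two other coordinates. *)
Lemma stereo_inj x y : dp x x = 1 -> dp y y = 1 -> D x -> D y ->
  stereo x = stereo y -> x = y.
Proof.
rewrite /D /= => x1 y1 Dx Dy [h1 h2].
have dx : 1 - dp q x != 0 by rewrite subr_eq0 eq_sym.
have dy : 1 - dp q y != 0 by rewrite subr_eq0 eq_sym.
move/eqP: h1; rewrite eqr_div// => /eqP h1.
move/eqP: h2; rewrite eqr_div// => /eqP h2.
rewrite parseval in x1; rewrite parseval in y1.
set a := dp e1 x in x1 h1 *; set b := dp e2 x in x1 h2 *.
set c := dp q x in dx x1 h1 h2 *.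
set a' := dp e1 y in y1 h1 *; set b' := dp e2 y in y1 h2 *.
set c' := dp q y in dy y1 h1 h2 *.
have s1 : a * a + b * b = (1 - c) * (1 + c) by lra.
have s2 : a' * a' + b' * b' = (1 - c') * (1 + c') by lra.
have cc : c = c'.
  have : (1 - c) * (1 - c') * ((1 + c) * (1 - c')) =
      (1 - c) * (1 - c') * ((1 + c') * (1 - c)).
    transitivity ((a * a + b * b) * (1 - c') ^+ 2); first by rewrite s1; ring.
    transitivity ((a' * a' + b' * b') * (1 - c) ^+ 2); last by rewrite s2; ring.
    transitivity ((a * (1 - c')) ^+ 2 + (b * (1 - c')) ^+ 2); first by ring.
    by rewrite h1 h2; ring.
  by move/(mulfI (mulf_neq0 dx dy)); lra.
rewrite -cc in h1 h2.
by apply: frame_eq => //; [exact: (mulIf dx) h1 | exact: (mulIf dx) h2].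
Qed.

Lemma stereo_continuous x : D x -> {for x, continuous stereo}.
Proof.
rewrite /D /= => Dx.
have dx : 1 - dp q x != 0 by rewrite subr_eq0 eq_sym.
have ci : {for x, continuous (fun y => (1 - dp q y)^-1)}.
  apply: (@cvgV _ _ (nbhs x)) => //.
  by apply: (@cvgB _ _ _ (nbhs x)); [exact: cvg_cst | exact: continuous_dp].
apply: continuous_pair; apply: (@cvgM _ _ (nbhs x)) => //; exact: continuous_dp.
Qed.

(** Combining the two components of the differential with the equations of the
    sphere and of its tangent plane gives [(1 - c) * s = 0] for the height [s]
    of [w]. *)
Lemma dstereo_inj x w : dp x x = 1 -> D x -> dp x w = 0 ->
  dstereo x w = 0 -> w = 0.
Proof.
rewrite /D /= => x1 Dx tan [h1 h2].
have dx : 1 - dp q x != 0 by rewrite subr_eq0 eq_sym.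
rewrite parseval in x1; rewrite parseval in tan.
set a := dp e1 x in x1 h1 tan *; set b := dp e2 x in x1 h2 tan *.
set c := dp q x in dx x1 h1 h2 tan *.
set p := dp e1 w in h1 tan *; set r := dp e2 w in h2 tan *.
set s := dp q w in h1 h2 tan *.
have k1 : p * (1 - c) + a * s = 0.
  rewrite -(mulr0 ((1 - c) ^+ 2)) -h1; field; exact: dx.
have k2 : r * (1 - c) + b * s = 0.
  rewrite -(mulr0 ((1 - c) ^+ 2)) -h2; field; exact: dx.
have s0 : s = 0.
  have : (1 - c) * s = 0.
    transitivity (a * (p * (1 - c) + a * s) + b * (r * (1 - c) + b * s)
      - (a * p + b * r + c * s) * (1 - c)
      - (a * a + b * b + c * c - 1) * s); first by ring.
    by rewrite k1 k2 tan x1; ring.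
  by move/eqP; rewrite mulf_eq0 (negPf dx) => /eqP.
have p0 : p = 0.
  by move/eqP: k1; rewrite s0 mulr0 addr0 mulf_eq0 (negPf dx) orbF => /eqP.
have r0 : r = 0.
  by move/eqP: k2; rewrite s0 mulr0 addr0 mulf_eq0 (negPf dx) orbF => /eqP.
exact: frame_eq0.
Qed.

Lemma dstereoD x (a b : R) w z :
  dstereo x (a *: w + b *: z) = a *: dstereo x w + b *: dstereo x z.
Proof.
by rewrite /dstereo !dpDr !dpZr; congr (_, _);
  rewrite /= /GRing.scale /=; ring.
Qed.

End SphereChart.

(** * Corner paths on the sphere *)
Section SpherePaths.
Variable R : realType.
Local Notation V := 'rV[R]_3.

Lemma is_derive_inv (F : R -> R) (u d : R) : is_derive u 1 F d -> F u != 0 ->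
  is_derive u 1 (fun t => (F t)^-1) (- d / F u ^+ 2).
Proof.
move=> dF F0; have dr := @ex_derive _ _ _ _ _ _ _ dF.
apply: DeriveDef; first exact: derivableV.
rewrite deriveV// (@derive_val _ _ _ _ _ _ _ dF) /GRing.scale /=.
by rewrite !mulNr mulrC.
Qed.

Lemma is_derive_stereo_coord (F G : R -> R) (u f' g' : R) :
  is_derive u 1 F f' -> is_derive u 1 G g' -> G u != 1 ->
  is_derive u 1 (fun t => F t / (1 - G t))
    (f' / (1 - G u) + F u * g' / (1 - G u) ^+ 2).
Proof.
move=> dF dG G1; have G0 : 1 - G u != 0 by rewrite subr_eq0 eq_sym.
have dI : is_derive u 1 (fun t => (1 - G t)^-1) (g' / (1 - G u) ^+ 2).
  have d1 : is_derive u 1 (fun t => 1 - G t) (- g').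
    by apply: is_derive_eq; rewrite /GRing.scale /=; ring.
  by have := is_derive_inv d1 G0; rewrite opprK.
by apply: is_derive_eq; rewrite /GRing.scale /=; field.
Qed.

Lemma tangent_derive (g : R -> V) u : (forall t, dp (g t) (g t) = 1) ->
  derivable g u 1 -> dp (g u) (derive1 g u) = 0.
Proof.
move=> g1 dg; have d2 := is_derive_dp_sqr dg.
have : 'D_1 (fun t => dp (g t) (g t)) u = 2 * dp (g u) (derive1 g u).
  exact: (@derive_val _ _ _ _ _ _ _ d2).
have -> : (fun t => dp (g t) (g t)) = cst 1 by apply/funext.
by rewrite derive_cst; lra.
Qed.

Section Tangent.
Variables v w : V.
Hypotheses (v1 : dp v v = 1) (vw : dp v w = 0).

Let speed h := 1 + h * h * dp w w.

(** Since [w] is tangent, the norm varies to the second order only, which is why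
    the radial projection does not affect the direction of the corner path. *)
Lemma tangent_norm h : euclidean_norm (v + h *: w) = Num.sqrt (speed h).
Proof.
rewrite euclidean_normE; congr Num.sqrt.
rewrite dpDr dpZr dpC dpDr dpZr v1 vw [dp (_ + _) w]dpC dpDr dpZr.
by rewrite (dpC w v) vw /speed; ring.
Qed.

Lemma speed_gt0 h : 0 < speed h.
Proof. by have := dp_ge0 w; rewrite /speed => w0; have := sqr_ge0 h; nra. Qed.

Let c h : V := corner_path (M := Sphere) v w h.

Lemma corner_pathE h : c h = (Num.sqrt (speed h))^-1 *: (v + h *: w).
Proof. by rewrite -tangent_norm. Qed.

Lemma corner_path0 : c 0 = v.
Proof.
by rewrite corner_pathE /speed !mul0r addr0 sqrtr1 invr1 scale1r scale0r addr0.
Qed.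

Lemma corner_path_sphere h : dp (c h) (c h) = 1.
Proof.
rewrite corner_pathE dpZr dpC dpZr mulrA -expr2.
have := tangent_norm h; rewrite euclidean_normE => e.
have -> : dp (v + h *: w) (v + h *: w) = speed h.
  by rewrite -[LHS]sqr_sqrtr ?dp_ge0// e sqr_sqrtr// ltW// speed_gt0.
by rewrite exprVn sqr_sqrtr ?mulVf// ?ltW ?gt_eqF ?speed_gt0.
Qed.

Lemma corner_path_continuous : continuous c.
Proof.
move=> h; have -> : c = fun h => (Num.sqrt (speed h))^-1 *: (v + h *: w).
  by apply/funext => h'; exact: corner_pathE.
apply: cvgZ.
  apply: cvgV; first by rewrite gt_eqF// sqrtr_gt0 speed_gt0.
  apply: (continuous_comp _ (@sqrt_continuous R _)).
  apply: cvgD; first exact: cvg_cst.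
  by apply: cvgM; [apply: cvgM|]; try exact: cvg_id; exact: cvg_cst.
apply: cvgD; first exact: cvg_cst.
by apply: cvgZr_tmp; exact: cvg_id.
Qed.

Lemma is_derive_corner_path e :
  is_derive (0 : R) 1 (fun h => dp e (c h)) (dp e w).
Proof.
have dS : is_derive (0 : R) 1 speed 0.
  by apply: is_derive_eq; rewrite /GRing.scale /=; ring.
have s0 : speed 0 = 1 by rewrite /speed !mul0r addr0.
have dq : is_derive (0 : R) 1 (fun h => Num.sqrt (speed h)) 0.
  have ds : is_derive (speed 0) 1 Num.sqrt (2 * Num.sqrt (speed 0))^-1.
    exact: is_derive1_sqrt (speed_gt0 0).
  by have := is_derive1_comp ds dS; rewrite mulr0.
have dI : is_derive (0 : R) 1 (fun h => (Num.sqrt (speed h))^-1) 0.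
  have n0 : Num.sqrt (speed 0) != 0 by rewrite s0 sqrtr1 oner_neq0.
  by have := is_derive_inv dq n0; rewrite oppr0 mul0r.
have -> : (fun h => dp e (c h)) =
    (fun h => (Num.sqrt (speed h))^-1 * (dp e v + h * dp e w)).
  by apply/funext => h; rewrite corner_pathE dpZr dpDr dpZr.
by apply: is_derive_eq; rewrite /GRing.scale /= s0 sqrtr1; field.
Qed.

End Tangent.
End SpherePaths.

(** * The chart of the sphere *)

Section SphereChartTheorem.
Variable R : realType.
Local Notation V := 'rV[R]_3.
Variables (g : R -> V) (q : V).
Hypothesis Hg : @generic_immersion R Sphere g.
Hypothesis Hq : (points R Sphere `\` range g) q.

Theorem sphere_chart : exists Psi D, @chart R Sphere g Psi D.
Proof.
have sphereE (x : V) : points R Sphere x <-> dp x x = 1.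
  exact: euclidean_norm_eq1.
have q1 : dp q q = 1 by apply/sphereE; case: Hq.
have qg u : g u <> q by move=> gu; case: Hq => _; apply; exists u.
have g1 u : dp (g u) (g u) = 1 by apply/sphereE; exact: gi_surface Hg u.
have [e1 [e2 parseval]] := orthonormal_frame q1.
have [e1q e2q] := pole_coord parseval q1.
have gD u : dp q (g u) != 1.
  by apply/eqP => /(sphere_pole parseval q1 (g1 u)); exact: qg.
have dg u : derivable g u 1 by exact: gi_derivable Hg u.
have cg : continuous (stereo e1 e2 q \o g).
  move=> u; apply: continuous_comp.
    by apply: differentiable_continuous; apply/derivable1_diffP; exact: dg.
  by apply: stereo_continuous; exact: gD.
exists (stereo e1 e2 q), [set x | dp q x != 1]; split.
- apply: (@open_comp _ _ (dp q) [set x : R | x != 1]); last exact: open_neq.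
  by move=> x _; exact: continuous_dp.
- by move=> x Dx; exact: stereo_continuous.
- move=> x y /sphereE x1 /sphereE y1 Dx Dy; exact: (stereo_inj parseval).
- exact: gD.
- move=> p /sphereE p1 /negP/negPn/eqP pq.
  have -> : p = q := sphere_pole parseval q1 p1 pq.
  have bound : \forall x \near q, forall u, 0 <= u <= 1 ->
      0 < 1 + dp q x - dot (dp e1 x, dp e2 x) (stereo e1 e2 q (g u)).
    apply: (@segment_near R V (nbhs q) _ (fun x u =>
      0 < 1 + dp q x - dot (dp e1 x, dp e2 x) (stereo e1 e2 q (g u)))) => u _.
    pose F (z : R * V) : R := 1 + dp q z.2 -
      dot (dp e1 z.2, dp e2 z.2) (stereo e1 e2 q (g z.1)).
    have cF : F z @[z --> (nbhs u, nbhs q)] --> F (u, q).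
      have c2 e : dp e z.2 @[z --> (nbhs u, nbhs q)] --> dp e q.
        by apply: (cvg_comp snd (dp e) cvg_snd); exact: continuous_dp.
      have c1 : (stereo e1 e2 q \o g) z.1 @[z --> (nbhs u, nbhs q)] -->
          (stereo e1 e2 q \o g) u.
        by apply: (cvg_comp fst _ cvg_fst); exact: cg.
      apply: cvgB; first by apply: cvgD; [exact: cvg_cst | exact: c2].
      apply: cvgD; apply: cvgM; try exact: c2.
        by apply: (cvg_comp _ fst c1); exact: cvg_fst.
      by apply: (cvg_comp _ snd c1); exact: cvg_snd.
    apply: (cvgr_gt _ cF).
    by rewrite /F /dot /= e1q e2q q1; lra.
  apply: filterS bound => x bound /sphereE x1 Dx.
  exists (- dp e1 x, - dp e2 x) => u.
  have [u' u'01 <-] := reduce_time Hg u.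
  have {}bound := bound u' (ltac:(lra)).
  have dx : 1 - dp q x != 0 by rewrite subr_eq0 eq_sym.
  suff e : dot (dp e1 x, dp e2 x) (stereo e1 e2 q x) = 1 + dp q x.
    rewrite dotB; move: bound; rewrite -e /dot /=; lra.
  have := parseval x x; rewrite x1 /dot /stereo /= => s.
  have s' : dp e1 x * dp e1 x + dp e2 x * dp e2 x =
    (1 + dp q x) * (1 - dp q x) by lra.
  by rewrite !mulrA -mulrDl s' mulfK.
- move=> s t v dd; have [_ _ _ gs gt] := dd.
  have v1 : dp v v = 1 by rewrite -gs.
  have vD : dp q v != 1 by rewrite -gs.
  have vel u : g u = v -> velocity (stereo e1 e2 q \o g) u
      (dstereo e1 e2 q v (derive1 g u)).
    move=> <-; apply: velocity_derive;
      exact: (is_derive_stereo_coord (is_derive_dp _ (dg u))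
        (is_derive_dp _ (dg u)) (gD u)).
  have tan u : g u = v -> dp v (derive1 g u) = 0.
    by move=> <-; exact: tangent_derive.
  exists (dstereo e1 e2 q v (derive1 g s)), (dstereo e1 e2 q v (derive1 g t)).
  split; [exact: vel | exact: vel | |].
  + apply/eqP => /cross_dependent[x [y [xy e]]].
    have [] := @row_free_pair _ _ _ _ x y (gi_transverse Hg dd); last by case: xy.
    rewrite -dstereoD in e; apply: (dstereo_inj parseval v1 vD _ e).
    exact: dp_orthogonal_span (tan s gs) (tan t gt).
  + move=> e f; rewrite -dstereoD; set w := _ *: _ + _.
    have vw : dp v w = 0 := dp_orthogonal_span _ _ (tan s gs) (tan t gt).
    have c0 := corner_path0 v1 vw.
    have -> : stereo e1 e2 q v =
        (stereo e1 e2 q \o corner_path (M := Sphere) v w) 0.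
      exact: (congr1 (stereo e1 e2 q) (esym c0)).
    have qc : dp q (corner_path (M := Sphere) v w 0) != 1 by rewrite c0.
    have dc e' := is_derive_stereo_coord (is_derive_corner_path v1 vw e')
      (is_derive_corner_path v1 vw q) qc.
    by apply: ray_derive; [have := dc e1 | have := dc e2]; rewrite c0.
- move=> s t v e f dd; have [_ _ _ gs gt] := dd.
  have v1 : dp v v = 1 by rewrite -gs.
  have tan u : g u = v -> dp v (derive1 g u) = 0.
    by move=> <-; exact: tangent_derive.
  set w := corner_vector _ _ _ _.
  have vw : dp v w = 0 := dp_orthogonal_span _ _ (tan s gs) (tan t gt).
  have cc := corner_path_continuous v1 vw.
  have near0 : \forall h \near (0 : R), dp q (corner_path (M := Sphere) v w h) != 1.
    have cq : dp q (corner_path (M := Sphere) v w h) @[h --> (0 : R)] --> dp q v.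
      rewrite -[in X in _ --> X](corner_path0 v1 vw).
      apply: (@continuous_comp _ _ _ (corner_path (M := Sphere) v w) (dp q)).
        exact: cc.
      exact: continuous_dp.
    by apply: (cq [set x | x != 1]); apply: open_nbhs_nbhs; split;
      [exact: open_neq | rewrite /= -gs].
  move: near0 => /nbhs_ballP[d /= d0 hd]; exists d; first exact: d0.
  move=> h /andP[h0 hd'].
  split; [|apply: hd|exact: cc].
    by apply/sphereE; exact: corner_path_sphere.
  by rewrite /ball /= sub0r normrN gtr0_norm.
Qed.

End SphereChartTheorem.

Theorem theorem3p1 (R : realType) (M : surface)
    (g : R -> 'rV[R]_(ambient_dim M)) (Hg : generic_immersion g)
    (n : nat)
    (v : 'I_n -> 'rV[R]_(ambient_dim M))
    (Hv : set_bij [set: 'I_n] (crossings g) v)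
    (r : 'I_(n + 2) -> set 'rV[R]_(ambient_dim M))
    (Hr : set_bij [set: 'I_(n + 2)] (regions g) r)
    (b : 'cV[int]_n) :
  exists u : 'cV[int]_(n + 2), region_choice_matrix g v r *m u + b = 0.
Proof.
case: M g Hg v Hv r Hr => g Hg v Hv r Hr.
- have j0 : 'I_(n + 2) by rewrite addn2; exact: ord0.
  have [rC _ _] := Hr; have [q Aq _] := rC j0 I.
  have [Psi [D Hc]] := sphere_chart Hg Aq.
  exact: chart_solution Hg Hc n v Hv r Hr b.
- exact: chart_solution Hg (plane_chart Hg) n v Hv r Hr b.
Qed.
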